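(* Let $n\ge 2$ and let $G\subset\overline{\mathbb{R}^n}$ be a domain (open connected set) with at least two boundary points. (i) If $0<q\le p\le\infty$, then for all $x,y\in G$, $$\delta_G^p(x,y)\le\delta_G^q(x,y)\le 2^{1/q-1/p}\,\delta_G^p(x,y).$$ (ii) If $0<q\le p\le\infty$ and additionally $G\subset\mathbb{R}^n$, then for all $x,y\in G$, $$j_G^p(x,y)\le j_G^q(x,y)\le 2^{1/q-1/p}\,j_G^p(x,y).$$ (iii) If $p\in[1,\infty]$ and $G\subset\mathbb{R}^n$, then for all $x,y\in G$, $$j_G^p(x,y)\le\delta_G^p(x,y)\le 2\,j_G^p(x,y).$$ Moreover, all of these inequalities are sharp. Here an inequality $d_1\le c\,d_2$ is called sharp if the constant $c$ cannot be improved, i.e. (for each admissible choice of the parameters $p$, respectively $p,q$) there exist a domain $G$ satisfying the respective hypotheses and points $x_i,y_i\in G$, $x_i\neq y_i$, $i=1,2,\dots$, such that $\lim_{i\to\infty}d_1(x_i,y_i)/d_2(x_i,y_i)=c$.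
   Context: $\overline{\mathbb{R}^n}=\mathbb{R}^n\cup\{\infty\}$ is the one-point compactification of $\mathbb{R}^n$, equipped with the spherical (chordal) metric, denoted here by $\sigma$: $$\sigma(x,y)=\frac{|x-y|}{\sqrt{1+|x|^2}\sqrt{1+|y|^2}}\quad (x,y\in\mathbb{R}^n),\qquad \sigma(x,\infty)=\frac{1}{\sqrt{1+|x|^2}}\quad (x\in\mathbb{R}^n),\qquad \sigma(\infty,\infty)=0.$$ All topological operations, in particular the boundary $\partial G$, are taken in $\overline{\mathbb{R}^n}$ (so $\infty\in\partial G$ for an unbounded $G\subset\mathbb{R}^n$). The cross-ratio of $a,b,c,d\in\overline{\mathbb{R}^n}$ with $a\ne b$, $c\ne d$ is $$|a,b,c,d|=\frac{\sigma(a,c)\,\sigma(b,d)}{\sigma(a,b)\,\sigma(c,d)},$$ which for $a,b,c,d\in\mathbb{R}^n$ equals $\dfrac{|a-c||b-d|}{|a-b||c-d|}$. For a domain $G\subset\overline{\mathbb{R}^n}$ with at least two boundary points, $x,y\in G$ and $0<p<\infty$, define $$\delta_G^p(x,y)=\sup_{a,b\in\partial G}\log\Bigl(1+\bigl(|x,a,y,b|^p+|x,b,y,a|^p\bigr)^{1/p}\Bigr),\qquad \delta_G^\infty(x,y)=\lim_{p\to\infty}\delta_G^p(x,y).$$ If $G\subset\mathbb{R}^n$, define for $0<p<\infty$ $$j_G^p(x,y)=\sup_{a\in\partial G}\log\left(1+\left(\frac{|x-y|^p}{|x-a|^p}+\frac{|x-y|^p}{|y-a|^p}\right)^{1/p}\right),\qquad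 j_G^\infty(x,y)=\lim_{p\to\infty}j_G^p(x,y),$$ where terms with $a=\infty$ are interpreted as $0$ (i.e. $1/|x-\infty|=0$). The convention $1/\infty=0$ is used in the exponent $1/q-1/p$. *)

(* Defs.v *)
From mathcomp Require Import all_boot all_order all_algebra.
From mathcomp Require Import all_classical all_reals all_analysis.
Set Implicit Arguments.
Unset Strict Implicit.
Unset Printing Implicit Defensive.
Import Order.TTheory GRing.Theory Num.Theory.
Import numFieldNormedType.Exports.
Local Open Scope classical_set_scope.
Local Open Scope ring_scope.

(* R^n with the point at infinity: [Some x] is the point x of R^n, [None] is
   infinity.  The topology is the library's one-point compactification of the
   usual topology of R^n, which is the one induced by [chordal] below. *)
Notation Rbar R n := (one_point_compactification 'rV[R]_n).

(* The library norm on row vectors is the sup norm, hence this definition. *)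
Definition eucl (R : realType) (n : nat) (x : 'rV[R]_n) : R :=
  Num.sqrt (\sum_(i < n) x 0 i ^+ 2).

Definition chordal (R : realType) (n : nat) (x y : Rbar R n) : R :=
  match x, y with
  | Some x', Some y' =>
      eucl (x' - y') /
      (Num.sqrt (1 + eucl x' ^+ 2) * Num.sqrt (1 + eucl y' ^+ 2))
  | Some x', None => 1 / Num.sqrt (1 + eucl x' ^+ 2)
  | None, Some y' => 1 / Num.sqrt (1 + eucl y' ^+ 2)
  | None, None => 0
  end.

Definition cross_ratio (R : realType) (n : nat) (a b c d : Rbar R n) : R :=
  (chordal a c * chordal b d) / (chordal a b * chordal c d).

Definition boundary (T : topologicalType) (G : set T) : set T :=
  closure G `\` interior G.

(* [connected set0] holds in the library; here G is nonempty because it has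
   boundary points. *)
Definition domain2 (R : realType) (n : nat) (G : set (Rbar R n)) : Prop :=
  [/\ open G, connected G &
      exists a b, [/\ boundary G a, boundary G b & a <> b]].

(* In [delta_fin] and [j_fin] the set under [sup] is nonempty and bounded above
   for x, y in a domain G with at least two boundary points, so that the real
   supremum is the genuine one; likewise the limits in [delta] and [j] exist. *)
Definition delta_fin (R : realType) (n : nat) (p : R)
    (G : set (Rbar R n)) (x y : Rbar R n) : R :=
  sup [set ln (1 + (cross_ratio x a y b `^ p + cross_ratio x b y a `^ p)
                     `^ (1 / p)) | a in boundary G & b in boundary G].

Definition delta (R : realType) (n : nat) (p : \bar R)
    (G : set (Rbar R n)) (x y : Rbar R n) : R :=
  match p with
  | r%:E => delta_fin r G x y
  | +oo%E => lim (delta_fin r G x y @[r --> +oo])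
  | -oo%E => 0
  end.

(* [s ^ p / |z - a| ^ p], which is 0 for a = infinity *)
Definition jterm (R : realType) (n : nat) (p s : R) (z : 'rV[R]_n)
    (a : Rbar R n) : R :=
  match a with
  | Some a' => s `^ p / eucl (z - a') `^ p
  | None => 0
  end.

(* The boundary is taken in the compactification, as for [delta]. *)
Definition j_fin (R : realType) (n : nat) (p : R)
    (G : set 'rV[R]_n) (x y : 'rV[R]_n) : R :=
  sup [set ln (1 + (jterm p (eucl (x - y)) x a + jterm p (eucl (x - y)) y a)
                     `^ (1 / p))
      | a in boundary (Some @` G : set (Rbar R n))].

Definition j (R : realType) (n : nat) (p : \bar R)
    (G : set 'rV[R]_n) (x y : 'rV[R]_n) : R :=
  match p with
  | r%:E => j_fin r G x y
  | +oo%E => lim (j_fin r G x y @[r --> +oo])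
  | -oo%E => 0
  end.

Definition domain2_fin (R : realType) (n : nat) (G : set 'rV[R]_n) : Prop :=
  domain2 (Some @` G : set (Rbar R n)).

Definition delta_on_Rn (R : realType) (n : nat) (p : \bar R)
    (G : set 'rV[R]_n) (x y : 'rV[R]_n) : R :=
  delta p (Some @` G : set (Rbar R n)) (Some x) (Some y).

(* 2 ^ (1/q - 1/p), with 1/oo = 0: the extended inverse of +oo is 0 *)
Definition const2 (R : realType) (q p : \bar R) : R :=
  2 `^ (fine (q^-1)%E - fine (p^-1)%E).

(* [d1 <= c * d2] is sharp over the class [D] of admissible domains of [T]. *)
Definition sharp (R : realType) (T : Type) (D : set T -> Prop)
    (d1 : set T -> T -> T -> R) (c : R) (d2 : set T -> T -> T -> R) : Prop :=
  exists (G : set T) (x y : nat -> T),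
    [/\ D G,
        forall i, [/\ G (x i), G (y i) & x i <> y i] &
        (d1 G (x i) (y i) / d2 G (x i) (y i)) @[i --> \oo] --> c].

(* Main.v *)
(* For each pair of boundary points, the quantity under the supremum is
   ln (1 + pnorm p u v) with (u, v) the two cross-ratios (for delta), or with
   (u, v) = (|x-y|/|x-a|, |x-y|/|y-a|) (for j).  The l^p norms on R^2 satisfy
   pnorm p <= pnorm q <= 2^(1/q-1/p) pnorm p, and ln (1 + c t) <= c ln (1 + t)
   for c >= 1; this gives (i) and (ii), and shows that the limits p -> oo are
   the suprema built from the max norm.

   For j <= delta in (iii), given a one takes b = oo if G is unbounded;
   otherwise b is a boundary point on the ray issued from the one of x, y
   farther from a, in the direction opposite to a.  For delta <= 2 j,
   |a-b| <= |a-x| + |x-y| + |y-b| bounds the cross-ratio by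
   (1 + |x-y|/|x-a|) (1 + |x-y|/|y-b|) - 1, and Minkowski's inequality gives
   1 + pnorm p u v <= (1 + J_a) (1 + J_b), where ln (1 + J_a) <= j.

   On R^n minus a point delta and j coincide and have a closed form, which
   yields all sharpness claims but the last: for the constant 1 let y run to
   infinity on a line, for 2^(1/q-1/p) take |x| = |y| and x - y -> 0.  For the
   constant 2 remove two points and let x, y tend to one of them each. *)

Require Import Defs.
From mathcomp Require Import all_boot all_order all_algebra.
From mathcomp Require Import all_classical all_reals all_analysis.
From mathcomp Require Import ring lra.
Import Order.TTheory GRing.Theory Num.Theory.
Import numFieldNormedType.Exports.
Local Open Scope classical_set_scope.
Local Open Scope ring_scope.

(** * The l^p norms on R^2 *)

Definition pnorm {R : realType} (p : \bar R) (u v : R) : R :=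
  if p is r%:E then (u `^ r + v `^ r) `^ (1 / r) else Num.max u v.

Section pnorm_theory.
Context {R : realType}.
Implicit Types (p q : \bar R) (u v x y r s t : R).

Lemma ler_powRl r x y : 0 <= r -> 0 <= x -> x <= y -> x `^ r <= y `^ r.
Proof.
move=> r0 x0 xy; apply: ge0_ler_powR => //; rewrite nnegrE//.
exact: le_trans xy.
Qed.

Lemma powR_div r x y : 0 <= x -> 0 <= y -> (x / y) `^ r = x `^ r / y `^ r.
Proof.
move=> x0 y0; rewrite powRM ?invr_ge0//; congr (_ * _).
by rewrite -(powR_inv1 y0) powRAC powR_inv1 ?powR_ge0.
Qed.

(** Split off one factor, [x ^ s = x * x ^ (s - 1)], and enlarge both [x ^ (s - 1)] and
    [y ^ (s - 1)] to [(x + y) ^ (s - 1)]. *)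
Lemma powR_superadd s x y : 1 <= s -> 0 <= x -> 0 <= y ->
  x `^ s + y `^ s <= (x + y) `^ s.
Proof.
move=> s1 x0 y0; have s0 : 0 < s by lra.
rewrite -!(@mulr_powRB1 _ _ s)// ?addr_ge0// mulrDl lerD// ler_wpM2l//
  ler_powRl//; lra.
Qed.

Lemma powR_convex s t x y : 1 <= s -> 0 <= t -> t <= 1 -> 0 <= x -> 0 <= y ->
  (t * x + (1 - t) * y) `^ s <= t * x `^ s + (1 - t) * y `^ s.
Proof.
move=> s1 t0 t1 x0 y0.
by apply: (convex_powR s1 (Itv01 t0 t1)) => /=; rewrite inE/= in_itv/= andbT.
Qed.

(** Midpoint convexity of the power, applied to [2 * x] and [2 * y]. *)
Lemma powR_subadd s x y : 1 <= s -> 0 <= x -> 0 <= y ->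
  (x + y) `^ s <= 2 `^ (s - 1) * (x `^ s + y `^ s).
Proof.
move=> s1 x0 y0; have s0 : 0 < s by lra.
have := @powR_convex s (1 / 2) (2 * x) (2 * y) s1.
have -> : 1 - 1 / 2 = 1 / 2 :> R by field.
rewrite !powRM// !mulrA (_ : 1 / 2 * 2 = 1 :> R); last by field.
rewrite !mul1r -mulrDr => /(_ _ _ _ _)/le_trans; apply; try lra.
by rewrite -(@mulr_powRB1 _ 2 s)// mulrA mulVf ?mul1r.
Qed.

Lemma pnorm_ge0 p u v : 0 <= u -> 0 <= pnorm p u v.
Proof. by case: p => [r| |] u0; rewrite /pnorm ?powR_ge0// le_max u0. Qed.

Lemma pnormC p u v : pnorm p u v = pnorm p v u.
Proof. by case: p => [r| |]; rewrite /pnorm 1?addrC// maxC. Qed.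

Lemma pnorm_powR r u v : 0 < r -> 0 <= u ->
  pnorm r%:E u v `^ r = u `^ r + v `^ r.
Proof.
move=> r0 u0; rewrite /pnorm -powRrM div1r mulVf ?gt_eqF// powRr1//.
by rewrite addr_ge0// powR_ge0.
Qed.

Lemma le_pnorm_powR r c u v : 0 < r -> 0 <= c ->
  u `^ r + v `^ r <= c `^ r -> pnorm r%:E u v <= c.
Proof.
move=> r0 c0 h; rewrite -[leRHS](powRr1 c0) -(@mulfV _ r) ?gt_eqF// powRrM.
by rewrite /pnorm div1r ler_powRl ?invr_ge0 ?addr_ge0 ?powR_ge0// ltW.
Qed.

Lemma ler_pnorm p u v x y : (0 < p)%E -> 0 <= u -> 0 <= v -> u <= x -> v <= y ->
  pnorm p u v <= pnorm p x y.
Proof.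
case: p => [r| |//]; rewrite ?lte_fin => r0 u0 v0 ux vy; rewrite /pnorm.
  have r1 := ltW r0.
  by rewrite ler_powRl ?divr_ge0 ?addr_ge0 ?powR_ge0// lerD// ler_powRl.
by rewrite ge_max !le_max ux vy orbT.
Qed.

Lemma pnormZ p c u v : (0 < p)%E -> 0 <= c -> 0 <= u -> 0 <= v ->
  pnorm p (c * u) (c * v) = c * pnorm p u v.
Proof.
case: p => [r| |//]; rewrite /pnorm ?lte_fin => r0 c0 u0 v0.
  rewrite !powRM// -mulrDr powRM ?powR_ge0 ?addr_ge0 ?powR_ge0//.
  by rewrite -powRrM div1r mulfV ?gt_eqF// powRr1.
by rewrite -maxr_pMr.
Qed.

Lemma le_pnorm_l p u v : (0 < p)%E -> 0 <= u -> 0 <= v -> u <= pnorm p u v.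
Proof.
case: p => [r| |//]; rewrite /pnorm ?lte_fin => r0 u0 v0;
  last by rewrite le_max lexx.
have {1}-> : u = (u `^ r) `^ (1 / r).
  by rewrite -powRrM div1r mulfV ?gt_eqF// powRr1.
by rewrite ler_powRl ?divr_ge0 ?powR_ge0 ?lerDl ?powR_ge0// ltW.
Qed.

(** Case principle for exponents [0 < q <= p]: both finite, only [p] infinite, or both infinite. *)
Lemma exponents_ind (P : \bar R -> \bar R -> Prop) :
  (forall r s, 0 < r -> r <= s -> P r%:E s%:E) ->
  (forall r, 0 < r -> P r%:E +oo%E) -> P +oo%E +oo%E ->
  forall q p, (0 < q)%E -> (q <= p)%E -> P q p.
Proof.
move=> h1 h2 h3 [q| |] [p| |] //.
- by rewrite lte_fin lee_fin; exact: h1.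
- by rewrite lte_fin => q0 _; exact: h2.
Qed.

(** For finite exponents write [p = q * s] with [s >= 1] and use superadditivity of the power [s] on
    [u ^ q] and [v ^ q]. For [p = +oo], each coordinate is below the norm. *)
Lemma pnorm_antitone p q u v : (0 < q)%E -> (q <= p)%E -> 0 <= u -> 0 <= v ->
  pnorm p u v <= pnorm q u v.
Proof.
move=> q0 qp u0 v0; move: q p q0 qp.
apply: exponents_ind => [q p q0 qp|q q0|].
- have p0 : 0 < p by exact: lt_le_trans qp.
  apply: le_pnorm_powR; rewrite ?pnorm_ge0//.
  have [s ps] : exists s, p = q * s by exists (p / q); field; rewrite gt_eqF.
  have s1 : 1 <= s by move: qp; rewrite ps ler_pMr.
  by rewrite ps !powRrM pnorm_powR// powR_superadd ?powR_ge0.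
- by rewrite {1}/pnorm ge_max le_pnorm_l// pnormC le_pnorm_l.
- exact: lexx.
Qed.

(** For finite exponents, [powR_subadd] with exponent [p / q] on [u ^ q] and [v ^ q], raised to the
    power [q / p]. For [p = +oo], [u ^ q + v ^ q] is at most twice the [q]-th power of the
    maximum. *)
Lemma pnorm_equiv p q u v : (0 < q)%E -> (q <= p)%E -> 0 <= u -> 0 <= v ->
  pnorm q u v <= const2 q p * pnorm p u v.
Proof.
rewrite /const2; move=> q0 qp u0 v0; move: q p q0 qp.
apply: exponents_ind => [q p q0 qp|q q0|].
- have p0 : 0 < p by exact: lt_le_trans qp.
  rewrite !inver !gt_eqF//=.
  apply: le_pnorm_powR; rewrite ?mulr_ge0 ?powR_ge0//.
  have u1 := powR_ge0 u q; have v1 := powR_ge0 v q.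
  have qp0 : 0 <= q / p by rewrite divr_ge0// ltW.
  have pq : p = q * (p / q) by field; rewrite gt_eqF.
  have qp1 : 1 <= p / q by rewrite ler_pdivlMr// mul1r.
  have := ler_powRl _ _ _ qp0 _ (powR_subadd (p / q) _ _ qp1 u1 v1).
  rewrite -!powRrM -pq (_ : p / q * (q / p) = 1); last first.
    by field; rewrite !gt_eqF.
  rewrite powRr1 ?addr_ge0 ?powR_ge0// => /(_ isT)/le_trans; apply.
  rewrite powRM ?powR_ge0 ?addr_ge0 ?powR_ge0// -powRrM.
  rewrite powRM ?powR_ge0 ?addr_ge0 ?powR_ge0// -!powRrM div1r.
  rewrite (_ : (p / q - 1) * (q / p) = (q^-1 - p^-1) * q); last first.
    by field; rewrite !gt_eqF.
  by rewrite (_ : p^-1 * q = q / p)// mulrC.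
- rewrite !inver invey gt_eqF//= subr0.
  apply: le_pnorm_powR; rewrite ?mulr_ge0 ?powR_ge0 ?le_max ?u0//.
  rewrite powRM ?powR_ge0 ?le_max ?u0// -powRrM mulVf ?gt_eqF// powRr1//.
  rewrite (_ : 2 * _ = (Num.max u v `^ q) + (Num.max u v `^ q)); last by ring.
  by rewrite lerD// ler_powRl ?le_max ?lexx ?orbT// ltW.
- by rewrite subrr powRr0 mul1r.
Qed.

Lemma const2_ge1 p q : (0 < q)%E -> (q <= p)%E -> 1 <= const2 q p.
Proof.
move=> q0 qp; rewrite /const2 -[leLHS](powRr0 2) ler_powR ?ler1n// subr_ge0.
move: q p q0 qp; apply: exponents_ind => [q p q0 qp|q q0|].
- have p0 : 0 < p by exact: lt_le_trans qp.
  by rewrite !inver !gt_eqF//= lef_pV2.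
- by rewrite invey inver gt_eqF//= invr_ge0 ltW.
- exact: lexx.
Qed.

(** Minkowski's inequality. If [A] and [B] are the two norms, [(u + x) / (A + B)] is the convex
    combination of [u / A] and [x / B] with weight [A / (A + B)]. Convexity of the power [r], summed
    over both coordinates, bounds the total by 1. *)
Lemma pnorm_triangle p u v x y : (1 <= p)%E ->
  0 <= u -> 0 <= v -> 0 <= x -> 0 <= y ->
  pnorm p (u + x) (v + y) <= pnorm p u v + pnorm p x y.
Proof.
case: p => [r| |//]; rewrite ?lee_fin => r1 u0 v0 x0 y0; last first.
  rewrite /= ge_max; apply/andP; split; apply: lerD;
    by rewrite le_max lexx ?orbT.
have r0 : 0 < r by lra.
have p0 : (0 < r%:E)%E by rewrite lte_fin.
have := pnorm_ge0 r%:E _ v u0; have := pnorm_ge0 r%:E _ y x0.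
have := le_pnorm_l _ _ _ p0 u0 v0; have := le_pnorm_l _ _ _ p0 v0 u0.
have := le_pnorm_l _ _ _ p0 x0 y0; have := le_pnorm_l _ _ _ p0 y0 x0.
have := pnorm_powR _ _ v r0 u0; have := pnorm_powR _ _ y r0 x0.
(* These instances settle the cases where one norm vanishes; they are recorded before the norms are
   abstracted into [A] and [B]. *)
have [] : pnorm r%:E (0 + x) (0 + y) = pnorm r%:E x y /\
          pnorm r%:E (u + 0) (v + 0) = pnorm r%:E u v by rewrite !add0r !addr0.
rewrite (pnormC _ v) (pnormC _ y).
move: (pnorm _ u v) (pnorm _ x y) => A B nA nB.
move=> powB powA yB xB vA uA; rewrite !le0r.
move=> /orP[B0 _|B0 /orP[A0|A0]].
- have [-> ->] : x = 0 /\ y = 0.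
    by split; apply/eqP; rewrite eq_le ?x0 ?y0 andbT -(eqP B0).
  by rewrite nB (eqP B0) addr0 lexx.
- have [-> ->] : u = 0 /\ v = 0.
    by split; apply/eqP; rewrite eq_le ?u0 ?v0 andbT -(eqP A0).
  by rewrite nA (eqP A0) add0r lexx.
have AB0 : 0 < A + B by rewrite addr_gt0.
have t0 : 0 <= A / (A + B) by rewrite divr_ge0 ?ltW.
have t1 : A / (A + B) <= 1 by rewrite ler_pdivrMr// mul1r lerDl ltW.
have h a b : 0 <= a -> 0 <= b -> (a + b) `^ r <= (A + B) `^ r *
    (A / (A + B) * (a `^ r / A `^ r) + (1 - A / (A + B)) * (b `^ r / B `^ r)).
  move=> a0 b0.
  have := powR_convex r _ _ _ r1 t0 t1 (divr_ge0 a0 (ltW A0))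
    (divr_ge0 b0 (ltW B0)).
  have -> : A / (A + B) * (a / A) + (1 - A / (A + B)) * (b / B) =
            (a + b) / (A + B) by field; rewrite !gt_eqF.
  by rewrite !powR_div ?addr_ge0 ?(ltW AB0) ?(ltW A0) ?(ltW B0)//
    ler_pdivrMr ?powR_gt0// mulrC.
apply: le_pnorm_powR => //; first exact: ltW.
apply: le_trans (lerD (h _ _ u0 x0) (h _ _ v0 y0)) _.
rewrite -mulrDr -[leRHS]mulr1 ler_wpM2l ?powR_ge0//.
set T := A / _ in t0 t1 *.
have eA : u `^ r / A `^ r + v `^ r / A `^ r = 1.
  by rewrite -mulrDl -powA mulfV// gt_eqF// powR_gt0.
have eB : x `^ r / B `^ r + y `^ r / B `^ r = 1.
  by rewrite -mulrDl -powB mulfV// gt_eqF// powR_gt0.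
set a1 := _ / _ in eA *; set a2 := _ / _ in eA *.
set b1 := _ / _ in eB *; set b2 := _ / _ in eB *.
have -> : T * a1 + (1 - T) * b1 + (T * a2 + (1 - T) * b2) =
  T * (a1 + a2) + (1 - T) * (b1 + b2) by ring.
by rewrite eA eB !mulr1 addrC subrK.
Qed.

Lemma pnorm_mul p u v x y : (0 < p)%E -> 0 <= u -> 0 <= v -> 0 <= x -> 0 <= y ->
  pnorm p (u * x) (v * y) <= pnorm p u v * pnorm p x y.
Proof.
move=> p0 u0 v0 x0 y0.
have h : pnorm p (u * x) (v * y) <= pnorm p (u * pnorm p x y) (v * pnorm p x y).
  by apply: ler_pnorm => //; rewrite ?mulr_ge0// ler_wpM2l// ?le_pnorm_l//
    pnormC le_pnorm_l.
apply: le_trans h _.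
by rewrite [u * _]mulrC [v * _]mulrC pnormZ ?pnorm_ge0// mulrC.
Qed.

(** Since [a * (a + b - 2) >= (a - 1) ^ 2], one has [a + b >= 2]; the difference of the two sides is
    [(x - y) * (a - 1) + y * (a + b - 2)]. *)
Lemma spread_aux x y a b : 0 < y -> y <= x -> 1 <= a -> 0 < b -> 1 <= a * b ->
  x + y <= x * a + y * b.
Proof.
move=> y0 yx a1 b0 ab.
have h : 0 <= a + b - 2.
  have a0 : 0 < a by lra.
  by rewrite -(pmulr_rge0 _ a0); nra.
nra.
Qed.

(* Convexity of t |-> t^-p, in the form needed along a ray. *)
Lemma pnorm_inv_spread p S T t : (0 < p)%E -> 0 < S -> S <= T -> 0 <= t ->
  t < S -> pnorm p S^-1 T^-1 <= pnorm p (S - t)^-1 (T + t)^-1.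
Proof.
move=> p0 S0 ST t0 tS.
have T0 : 0 < T by lra.
have St0 : 0 < S - t by lra.
have Tt0 : 0 < T + t by lra.
have TS : T^-1 <= S^-1 by rewrite lef_pV2 ?posrE.
have SSt : S^-1 <= (S - t)^-1 by rewrite lef_pV2 ?posrE//; lra.
case: p p0 => [r| |//]; rewrite ?lte_fin => r0; last first.
  rewrite /= ge_max; apply/andP; split; rewrite le_max.
    by rewrite SSt.
  by rewrite (le_trans TS SSt).
rewrite /pnorm ler_powRl ?divr_ge0 ?addr_ge0 ?powR_ge0 ?(ltW r0)//.
(* The factors by which the two inverses change. Their product is at least 1 because
   [(S - t) * (T + t) <= S * T] when [S <= T]. *)
set a := S / (S - t); set b := T / (T + t).
have a0 : 0 < a by rewrite divr_gt0.
have b0 : 0 < b by rewrite divr_gt0.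
have -> : (S - t)^-1 = S^-1 * a by rewrite /a; field; rewrite !gt_eqF.
have -> : (T + t)^-1 = T^-1 * b by rewrite /b; field; rewrite !gt_eqF.
rewrite (@powRM _ S^-1 a) ?invr_ge0 ?(ltW S0) ?(ltW a0)//.
rewrite (@powRM _ T^-1 b) ?invr_ge0 ?(ltW T0) ?(ltW b0)//.
set x := S^-1 `^ r; set y := T^-1 `^ r.
have y0 : 0 < y by rewrite powR_gt0// invr_gt0.
have yx : y <= x by rewrite ler_powRl ?invr_ge0 ?(ltW r0) ?(ltW T0).
have a1 : 1 <= a `^ r.
  rewrite -[leLHS](powRr0 a) ler_powR ?(ltW r0)// /a ler_pdivlMr// mul1r.
  by rewrite lerBlDr lerDl.
have b1 : 0 < b `^ r by rewrite powR_gt0.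
have ab : 1 <= a `^ r * b `^ r.
  rewrite -powRM ?(ltW a0) ?(ltW b0)// -[leLHS](powRr0 (a * b)).
  rewrite ler_powR ?(ltW r0)//.
  have -> : a * b = (S * T) / ((S - t) * (T + t)).
    by rewrite /a /b; field; rewrite !gt_eqF.
  rewrite ler_pdivlMr ?mulr_gt0// mul1r.
  by clear -ST t0 tS; nra.
exact: spread_aux.
Qed.

Lemma ln1p_ge0 t : 0 <= t -> 0 <= ln (1 + t).
Proof. by move=> t0; rewrite ln_ge0//; lra. Qed.

Lemma ler_ln1p s t : 0 <= s -> s <= t -> ln (1 + s) <= ln (1 + t).
Proof. by move=> s0 st; rewrite ler_ln ?posrE; lra. Qed.

(** Concavity of [ln]: [1 + t] is the convex combination of [1 + c * t] and 1 with weight [c^-1]. *)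
Lemma ln1pM c t : 1 <= c -> 0 <= t -> ln (1 + c * t) <= c * ln (1 + t).
Proof.
move=> c1 t0; have c0 : 0 < c by lra.
have i0 : 0 <= c^-1 by rewrite invr_ge0 ltW.
have i1 : c^-1 <= 1 by rewrite invf_le1.
have ct : 0 <= c * t by rewrite mulr_ge0// ltW.
have := @concave_ln R (Itv01 i0 i1) (1 + c * t) 1 ltac:(lra) ltr01.
rewrite !convRE /= ln1 mulr0 addr0 (_ : unstable.onem c^-1 = 1 - c^-1)//.
have -> : c^-1 * (1 + c * t) + (1 - c^-1) * 1 = 1 + t by field; rewrite gt_eqF.
by rewrite ler_pdivrMl.
Qed.

End pnorm_theory.

(** * Suprema of logarithms over sets of pairs *)

Definition logsup {R : realType} (p : \bar R) (W : set (R * R)) : R :=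
  sup [set ln (1 + pnorm p w.1 w.2) | w in W].

(** Makes the supremum in [logsup] genuine: the set is nonempty, and by monotonicity of [pnorm] the
    pair [(M, M)] provides an upper bound. *)
Definition bounded_pairs {R : realType} (W : set (R * R)) : Prop :=
  W !=set0 /\ exists M : R, forall w, W w ->
    (0 <= w.1 /\ w.1 <= M) /\ (0 <= w.2 /\ w.2 <= M).

Section logsup_theory.
Context {R : realType}.
Implicit Types (p q : \bar R) (W : set (R * R)).

Lemma le_logsup p W w : (0 < p)%E -> bounded_pairs W -> W w ->
  ln (1 + pnorm p w.1 w.2) <= logsup p W.
Proof.
move=> p0 [_ [M Wb]] Ww; apply: ub_le_sup; last by exists w.
exists (ln (1 + pnorm p M M)) => _ [[u v] /Wb/= [[u0 uM] [v0 vM]] <-].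
by apply: ler_ln1p; rewrite ?pnorm_ge0// ler_pnorm.
Qed.

Lemma logsup_le p W c : W !=set0 ->
  (forall w, W w -> ln (1 + pnorm p w.1 w.2) <= c) -> logsup p W <= c.
Proof.
move=> [w Ww] h; apply: ge_sup; first by exists (ln (1 + pnorm p w.1 w.2)), w.
by move=> _ [z Wz <-]; exact: h.
Qed.

Lemma logsup_antitone p q W : (0 < q)%E -> (q <= p)%E -> bounded_pairs W ->
  logsup p W <= logsup q W.
Proof.
move=> q0 qp Wb; have [W0 [M hM]] := Wb.
apply: logsup_le => // w Ww; apply: le_trans (le_logsup _ _ _ q0 Wb Ww).
have [[u0 _] [v0 _]] := hM _ Ww.
by apply: ler_ln1p; rewrite ?pnorm_ge0// pnorm_antitone.
Qed.

Lemma logsup_equiv p q W : (0 < q)%E -> (q <= p)%E -> bounded_pairs W ->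
  logsup q W <= const2 q p * logsup p W.
Proof.
move=> q0 qp Wb; have [W0 [M hM]] := Wb.
have c1 := const2_ge1 _ _ q0 qp.
apply: logsup_le => // w Ww; have [[u0 _] [v0 _]] := hM _ Ww.
have := le_logsup _ _ _ (lt_le_trans q0 qp) Wb Ww.
move/(ler_wpM2l (le_trans ler01 c1)); apply: le_trans.
apply: le_trans (ln1pM _ _ c1 (pnorm_ge0 _ _ _ u0)).
by apply: ler_ln1p; rewrite ?pnorm_ge0// pnorm_equiv.
Qed.

Lemma logsup_max p W u v : bounded_pairs W -> (0 < p)%E -> W (u, v) ->
  (forall w, W w -> pnorm p w.1 w.2 <= pnorm p u v) ->
  logsup p W = ln (1 + pnorm p u v).
Proof.
move=> Wb p0 Wuv h; have [_ [M hM]] := Wb.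
apply/eqP; rewrite eq_le (le_logsup _ _ _ p0 Wb Wuv) andbT.
apply: logsup_le; first by exists (u, v).
move=> w Ww; apply: ler_ln1p; last exact: h.
by apply: pnorm_ge0; have [[]] := hM _ Ww.
Qed.

(** By [logsup_antitone] and [logsup_equiv], [logsup r%:E W] lies between [logsup +oo W] and 2^(1/r)
    times it, and that factor tends to 1. The bound is uniform over [W], so limit and supremum
    commute. *)
Lemma logsup_cvg W : bounded_pairs W ->
  logsup r%:E W @[r --> +oo] --> logsup +oo W.
Proof.
move=> Wb.
have inv0 : (r^-1 : R) @[r --> +oo] --> (0 : R).
  by apply/gtr0_cvgV0; [exact: nbhs_pinfty_gt|exact: cvg_id].
have pow1 : const2 r%:E +oo @[r --> +oo] --> (1 : R).
  have e : expR (r^-1 * ln 2) @[r --> +oo] --> (1 : R).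
    suff : expR (r^-1 * ln 2) @[r --> +oo] --> expR (0 * ln 2 : R).
      by rewrite mul0r expR0.
    apply: (cvg_comp _ (@expR R)); last exact: continuous_expR.
    exact: cvgMr_tmp.
  apply: cvg_trans e; apply: near_eq_cvg; near=> r.
  have r0 : 0 < r by near: r; exact: nbhs_pinfty_gt.
  by rewrite /const2 inver gt_eqF//= subr0 /powR pnatr_eq0.
apply: (@squeeze_cvgr _ _ _ _ (fun=> logsup +oo W)
  (fun r => const2 r%:E +oo * logsup +oo W)).
- near=> r.
  have r0 : (0 < r%:E)%E by rewrite lte_fin; near: r; exact: nbhs_pinfty_gt.
  by rewrite logsup_antitone ?leey// logsup_equiv ?leey.
- exact: cvg_cst.
- rewrite -[X in _ --> X]mul1r; exact: cvgMr_tmp.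
Unshelve. all: by end_near.
Qed.
End logsup_theory.

(** * Euclidean and chordal distances *)

Section eucl_theory.
Context {R : realType} {n : nat}.
Implicit Types (x y z : 'rV[R]_n) (a b : Rbar R n).

Let sumsq_ge0 x : 0 <= \sum_(i < n) x 0 i ^+ 2.
Proof. by apply: sumr_ge0 => i _; exact: sqr_ge0. Qed.

Lemma eucl_ge0 x : 0 <= eucl x.
Proof. exact: sqrtr_ge0. Qed.

Lemma sqr_eucl x : eucl x ^+ 2 = \sum_(i < n) x 0 i ^+ 2.
Proof. by rewrite sqr_sqrtr. Qed.

Lemma ler_coord_eucl x i : `|x 0 i| <= eucl x.
Proof.
rewrite -sqrtr_sqr ler_sqrt// (bigD1 i)//= lerDl.
by apply: sumr_ge0 => k _; exact: sqr_ge0.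
Qed.

Lemma ler_norm_eucl x : `|x| <= eucl x.
Proof.
rewrite [leLHS]mx_normrE; apply/bigmax_leP.
split=> [|[i k] _]; first exact: eucl_ge0.
by rewrite (ord1 i) ler_coord_eucl.
Qed.

Lemma ler_coord_norm x i : `|x 0 i| <= `|x|.
Proof. by rewrite [leRHS]mx_normrE; apply/bigmax_geP; right; exists (0, i). Qed.

Lemma eucl_le_norm x M : `|x| <= M -> eucl x <= Num.sqrt (n%:R * M ^+ 2).
Proof.
move=> xM; apply: ler_wsqrtr; rewrite mulr_natl -[in leRHS](card_ord n) -sumr_const.
apply: ler_sum => i _; rewrite -real_normK ?num_real// lerXn2r ?nnegrE//.
  exact: le_trans xM.
exact: le_trans (ler_coord_norm _ _) xM.
Qed.

Lemma eucl_eq0 x : (eucl x == 0) = (x == 0).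
Proof.
apply/eqP/eqP => [x0|->].
  by apply/eqP; rewrite -normr_le0 -x0 ler_norm_eucl.
by rewrite /eucl big1 ?sqrtr0// => i _; rewrite mxE expr0n.
Qed.

Lemma eucl_gt0 x : (0 < eucl x) = (x != 0).
Proof. by rewrite lt_def eucl_ge0 andbT eucl_eq0. Qed.

Lemma euclZ (c : R) x : eucl (c *: x) = `|c| * eucl x.
Proof.
rewrite /eucl -sqrtr_sqr -sqrtrM ?sqr_ge0// mulr_sumr; congr Num.sqrt.
by apply: eq_bigr => i _; rewrite mxE exprMn.
Qed.

Lemma euclN x : eucl (- x) = eucl x.
Proof. by rewrite -scaleN1r euclZ normrN1 mul1r. Qed.

Lemma euclB x y : eucl (x - y) = eucl (y - x).
Proof. by rewrite -euclN opprB. Qed.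

(** Cauchy-Schwarz: sum the inequalities [0 <= (B * x 0 i - A * y 0 i) ^+ 2] over [i] and divide by
    [2 * A * B]. *)
Lemma dot_le_eucl x y : \sum_(i < n) x 0 i * y 0 i <= eucl x * eucl y.
Proof.
have [->|x0] := eqVneq x 0.
  by rewrite big1 ?mulr_ge0 ?eucl_ge0// => i _; rewrite mxE mul0r.
have [->|y0] := eqVneq y 0.
  by rewrite big1 ?mulr_ge0 ?eucl_ge0// => i _; rewrite mxE mulr0.
rewrite -eucl_gt0 in x0; rewrite -eucl_gt0 in y0.
set A := eucl x in x0 *; set B := eucl y in y0 *.
have h : \sum_(i < n) 2 * A * B * (x 0 i * y 0 i) <=
         \sum_(i < n) (B ^+ 2 * x 0 i ^+ 2 + A ^+ 2 * y 0 i ^+ 2).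
  apply: ler_sum => i _; have := sqr_ge0 (B * x 0 i - A * y 0 i).
  by rewrite -subr_ge0; congr (_ <= _); ring.
move: h; rewrite -mulr_sumr big_split/= -!mulr_sumr -!sqr_eucl -/A -/B.
set s := \sum_(i < n) _ => h.
rewrite -(ler_pM2l (_ : 0 < 2 * A * B)); last by rewrite !mulr_gt0.
by apply: le_trans h _; rewrite le_eqVlt; apply/orP; left; apply/eqP; ring.
Qed.

Lemma ler_euclD x y : eucl (x + y) <= eucl x + eucl y.
Proof.
rewrite -(@ler_pXn2r _ 2)// ?nnegrE ?addr_ge0 ?eucl_ge0//.
rewrite sqrrD !sqr_eucl.
have -> : \sum_(i < n) (x + y) 0 i ^+ 2 = \sum_(i < n) x 0 i ^+ 2 +
    (\sum_(i < n) x 0 i * y 0 i) *+ 2 + \sum_(i < n) y 0 i ^+ 2.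
  rewrite -sumrMnl -!big_split/=; apply: eq_bigr => i _.
  by rewrite mxE sqrrD.
by rewrite lerD2r lerD2l lerMn2r /= dot_le_eucl.
Qed.

Lemma ler_dist_euclD z x y : eucl (x - y) <= eucl (x - z) + eucl (z - y).
Proof.
have -> : x - y = (x - z) + (z - y) by rewrite addrA subrK.
exact: ler_euclD.
Qed.

Lemma eucl_delta (i : 'I_n) : eucl (delta_mx 0 i : 'rV[R]_n) = 1.
Proof.
rewrite /eucl (bigD1 i)//= big1 => [|k ki].
  by rewrite mxE !eqxx expr1n addr0 sqrtr1.
by rewrite mxE (negPf ki) andbF expr0n.
Qed.

Let weight x : R := Num.sqrt (1 + eucl x ^+ 2).

Let weight_gt0 x : 0 < weight x.
Proof. by rewrite sqrtr_gt0 ltr_wpDr ?sqr_ge0. Qed.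

Let weight_neq0 x : weight x != 0.
Proof. by rewrite gt_eqF. Qed.

Let weight_ge1 x : 1 <= weight x.
Proof. by rewrite -[leLHS]sqrtr1 ler_wsqrtr// lerDl sqr_ge0. Qed.

Let weight_le x : weight x <= 1 + eucl x.
Proof.
have h := eucl_ge0 x.
rewrite -[leRHS]ger0_norm ?addr_ge0// -sqrtr_sqr ler_wsqrtr//.
by rewrite sqrrD expr1n lerD2r mul1r lerDl mulrn_wge0.
Qed.

Lemma chordalC a b : chordal a b = chordal b a.
Proof. by case: a b => [a|] [b|]//=; rewrite euclB [X in _ / X]mulrC. Qed.

Lemma chordal_ge0 a b : 0 <= chordal a b.
Proof.
by case: a b => [a|] [b|]//=; rewrite divr_ge0 ?mulr_ge0 ?sqrtr_ge0.
Qed.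

Lemma chordal_le1 a b : chordal a b <= 1.
Proof.
case: a b => [a|] [b|]//=; rewrite -?/(weight _).
- rewrite ler_pdivrMr ?mulr_gt0// mul1r.
  apply: le_trans (ler_euclD _ _) _; rewrite euclN.
  rewrite -(@ler_pXn2r _ 2)// ?nnegrE ?addr_ge0 ?mulr_ge0 ?eucl_ge0 ?sqrtr_ge0//.
  rewrite /weight exprMn !sqr_sqrtr ?addr_ge0 ?sqr_ge0//.
  (* The product of the squared weights minus the square of [eucl a + eucl b] is a perfect
     square. *)
  rewrite -subr_ge0 [leRHS](_ : _ = (1 - eucl a * eucl b) ^+ 2) ?sqr_ge0//.
  by rewrite -!sqr_eucl; ring.
- by rewrite ler_pdivrMr// mul1r.
- by rewrite ler_pdivrMr// mul1r.
Qed.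

Lemma cross_ratio_ge0 a b c d : 0 <= @cross_ratio R n a b c d.
Proof. by rewrite /cross_ratio divr_ge0 ?mulr_ge0 ?chordal_ge0. Qed.

(* The distance to the point at infinity is infinite, so its inverse is 0. *)
Definition invdist z a : R := if a is Some a' then (eucl (z - a'))^-1 else 0.

Lemma invdist_ge0 z a : 0 <= invdist z a.
Proof. by case: a => [a|]//=; rewrite invr_ge0 eucl_ge0. Qed.

Lemma jtermE p (s : R) z a : 0 < p -> 0 <= s ->
  jterm p s z a = (s * invdist z a) `^ p.
Proof.
move=> p0 s0; case: a => [a|] /=; first by rewrite powR_div ?eucl_ge0.
by rewrite mulr0 powR0// gt_eqF.
Qed.

Lemma cross_ratioE x y u v : x <> u -> y <> v ->
  @cross_ratio R n (Some x) (Some u) (Some y) (Some v) =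
  eucl (x - y) * eucl (u - v) * invdist x (Some u) * invdist y (Some v).
Proof.
move=> xu yv; rewrite /cross_ratio /= -!/(weight _).
have /gt_eqF h1 : 0 < eucl (x - u).
  by rewrite eucl_gt0 subr_eq0; apply/eqP.
have /gt_eqF h2 : 0 < eucl (y - v).
  by rewrite eucl_gt0 subr_eq0; apply/eqP.
by field; rewrite !weight_neq0 h1 h2.
Qed.

(** With one point at infinity the cross-ratio reduces to a single quotient, the very one that
    occurs in [j]; this links [delta] with [j]. *)
Lemma cross_ratioEr x y u : x <> u ->
  @cross_ratio R n (Some x) (Some u) (Some y) None =
  eucl (x - y) * invdist x (Some u).
Proof.
move=> xu; rewrite /cross_ratio /= -!/(weight _).
have /gt_eqF h1 : 0 < eucl (x - u).
  by rewrite eucl_gt0 subr_eq0; apply/eqP.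
by field; rewrite !weight_neq0 h1.
Qed.

Lemma cross_ratioEl x y v : y <> v ->
  @cross_ratio R n (Some x) None (Some y) (Some v) =
  eucl (x - y) * invdist y (Some v).
Proof.
move=> yv; rewrite /cross_ratio /= -!/(weight _).
have /gt_eqF h2 : 0 < eucl (y - v).
  by rewrite eucl_gt0 subr_eq0; apply/eqP.
by field; rewrite !weight_neq0 h2.
Qed.

Lemma cross_ratio_diag c d a : @cross_ratio R n c a d a = 0.
Proof.
rewrite /cross_ratio (_ : chordal a a = 0) ?mulr0 ?mul0r//.
by case: a => [a|]//=; rewrite subrr (_ : eucl 0 = 0) ?mul0r//; apply/eqP;
  rewrite eucl_eq0.
Qed.

(** The constant [K] is chosen so that [weight u <= 1 + eucl u <= K * eucl (x - u)] as soon as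
    [e <= eucl (x - u)]. Since [K >= 1], the same bound holds at infinity. *)
Lemma chordal_far x e : 0 < e -> exists2 c, 0 < c &
  forall b, (forall u, b = Some u -> e <= eucl (x - u)) ->
    c <= chordal (Some x : Rbar R n) b.
Proof.
move=> e0; pose K := (1 + eucl x) / e + 1.
have K1 : 1 <= K by rewrite lerDr divr_ge0 ?addr_ge0 ?eucl_ge0 ?ltW.
have K0 : 0 < K by exact: lt_le_trans K1.
exists (weight x * K)^-1; first by rewrite invr_gt0 mulr_gt0.
move=> [u|] h /=; rewrite -!/(weight _).
- have xu := h _ erefl.
  have xu0 := lt_le_trans e0 xu.
  rewrite ler_pdivlMr ?mulr_gt0// mulrC.
  rewrite -mulf_div mulrC ?mulr_gt0//.
  have -> : weight u / K * (weight x / weight x) = weight u / K.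
    by rewrite mulfV ?mulr1// gt_eqF.
  rewrite ler_pdivrMr//; apply: le_trans (weight_le u) _.
  have h1 : eucl u <= eucl x + eucl (x - u).
    by have := ler_euclD x (u - x); rewrite subrKC (euclB u).
  have h2 : 1 + eucl x <= eucl (x - u) * ((1 + eucl x) / e).
    rewrite mulrCA ler_peMr ?addr_ge0 ?eucl_ge0// ler_pdivlMr// mul1r.
    exact: xu.
  by rewrite /K mulrDr mulr1; lra.
- by rewrite div1r lef_pV2 ?posrE ?mulr_gt0// ler_peMr// ltW.
Qed.

End eucl_theory.

(** * Boundary points and the suprema *)

Section boundary_theory.
Context {R : realType} {n : nat}.
Implicit Types (G : set (Rbar R n)) (x y : 'rV[R]_n) (a b : Rbar R n).

Lemma boundary_notin (T : topologicalType) (A : set T) (t : T) :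
  open A -> boundary A t -> ~ A t.
Proof. by move=> /interior_id Ao [_]; rewrite Ao. Qed.

Lemma boundary_some_far G x : open G -> G (Some x) ->
  exists2 e, 0 < e & forall u, boundary G (Some u) -> e <= eucl (x - u).
Proof.
move=> Go Gx.
have : nbhs (Some x : Rbar R n) G by exact: open_nbhs_nbhs.
(* Neighbourhoods of a finite point in the compactification are, by definition, the sets whose
   preimage is a neighbourhood in R^n. *)
change (nbhs x (Some @^-1` G) ->
  exists2 e, 0 < e & forall u, boundary G (Some u) -> e <= eucl (x - u)).
move=> /nbhs_ballP[e /= e0 eG]; exists e => // u Gu.
rewrite leNgt; apply/negP => ue; apply: (boundary_notin _ _ _ Go Gu).
apply: eG; rewrite -ball_normE /ball_/=.
exact: le_lt_trans (ler_norm_eucl _) ue.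
Qed.

Lemma boundary_chordal_far G a : open G -> G a ->
  exists2 c, 0 < c & forall b, boundary G b -> c <= chordal a b.
Proof.
case: a => [x|] Go Ga.
  have [e e0 he] := boundary_some_far _ _ Go Ga.
  have [c c0 hc] := chordal_far x _ e0.
  by exists c => // b Gb; apply: hc => u bu; apply: he; rewrite -bu.
(* Since G is a neighbourhood of infinity, its complement, and hence its boundary, lies in a compact
   set. *)
have : nbhs (None : Rbar R n) G by exact: open_nbhs_nbhs.
move=> [K [Kc _] KG].
have [M [_ hM]] := compact_bounded Kc.
(* [compact_bounded] bounds the sup norm by any number above [M], hence [M + 1]; the factor [n]
   passes to the Euclidean norm. *)
pose C := Num.sqrt (n%:R * (M + 1) ^+ 2).
exists (1 / Num.sqrt (1 + C ^+ 2)).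
  by rewrite div1r invr_gt0 sqrtr_gt0 ltr_wpDr ?sqr_ge0.
move=> [u|] Gb; last by have := boundary_notin _ _ _ Go Gb.
have Ku : K u.
  apply: contrapT => nKu; apply: (boundary_notin _ _ _ Go Gb).
  by apply: KG; left; exists u.
have uC : eucl u <= C.
  by apply: eucl_le_norm; apply: (hM (M + 1)); rewrite ?ltrDl.
rewrite /= !div1r lef_pV2 ?posrE ?sqrtr_gt0 ?ltr_wpDr ?sqr_ge0//.
by rewrite ler_wsqrtr// lerD2l lerXn2r// nnegrE ?eucl_ge0 ?sqrtr_ge0.
Qed.

Definition cross_ratio_pairs G a b : set (R * R) :=
  [set (cross_ratio a u b v, cross_ratio a v b u)
  | u in boundary G & v in boundary G].

Definition inv_distance_pairs (G : set 'rV[R]_n) x y : set (R * R) :=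
  [set (eucl (x - y) * invdist x a, eucl (x - y) * invdist y a)
  | a in boundary (Some @` G : set (Rbar R n))].

(** The numerator of a cross-ratio is at most 1, and its denominator is bounded below because [a]
    and [b] keep a positive chordal distance from the boundary. *)
Lemma cross_ratio_pairs_bounded G a b : domain2 G -> G a -> G b ->
  bounded_pairs (cross_ratio_pairs G a b).
Proof.
move=> [Go _ [u [_ [Gu _ _]]]] Ga Gb; split.
  by eexists; exists u => //; exists u.
have [c c0 hc] := boundary_chordal_far _ _ Go Ga.
have [d d0 hd] := boundary_chordal_far _ _ Go Gb.
have cr_le v w : boundary G v -> boundary G w ->
    cross_ratio a v b w <= (c * d)^-1.
  move=> Gv Gw; rewrite /cross_ratio -[leRHS]mul1r.
  apply: ler_pM; rewrite ?mulr_ge0 ?invr_ge0 ?mulr_ge0 ?chordal_ge0//.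
    by rewrite mulr_ile1 ?chordal_ge0 ?chordal_le1.
  have hv := hc _ Gv; have hw := hd _ Gw.
  rewrite lef_pV2 ?posrE ?mulr_gt0 ?(lt_le_trans c0 hv) ?(lt_le_trans d0 hw)//.
  by apply: ler_pM; rewrite ?(ltW c0) ?(ltW d0).
exists (c * d)^-1 => _ [v Gv [w Gw <-]] /=.
by rewrite !cross_ratio_ge0 !cr_le.
Qed.

Lemma inv_distance_pairs_bounded (G : set 'rV[R]_n) x y : domain2_fin G ->
  G x -> G y -> bounded_pairs (inv_distance_pairs G x y).
Proof.
move=> [Go _ [a [_ [Ga _ _]]]] Gx Gy; split; first by eexists; exists a.
have [c c0 hc] := boundary_some_far _ _ Go (imageP Some Gx).
have [d d0 hd] := boundary_some_far _ _ Go (imageP Some Gy).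
have inv_le (z : 'rV[R]_n) (e : R) b : 0 < e ->
    (forall u, boundary (Some @` G : set (Rbar R n)) (Some u) ->
      e <= eucl (z - u)) ->
    boundary (Some @` G : set (Rbar R n)) b -> invdist z b <= e^-1.
  case: b => [u|] e0 h Gb /=; last by rewrite invr_ge0 ltW.
  by have hu := h _ Gb; rewrite lef_pV2 ?posrE ?(lt_le_trans e0 hu).
exists (eucl (x - y) * c^-1 + eucl (x - y) * d^-1) => _ [b Gb <-] /=.
have d1 := eucl_ge0 (x - y).
rewrite !mulr_ge0 ?invdist_ge0//; split; split=> //.
  apply: le_trans (ler_wpM2l d1 (inv_le _ _ _ c0 hc Gb)) _.
  by rewrite lerDl mulr_ge0// invr_ge0 ltW.
apply: le_trans (ler_wpM2l d1 (inv_le _ _ _ d0 hd Gb)) _.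
by rewrite lerDr mulr_ge0// invr_ge0 ltW.
Qed.

Lemma delta_finE (r : R) G a b :
  delta_fin r G a b = logsup r%:E (cross_ratio_pairs G a b).
Proof.
rewrite /delta_fin /logsup; congr sup; apply/seteqP; split.
  move=> _ [u Gu [v Gv <-]].
  exists (cross_ratio a u b v, cross_ratio a v b u) => //.
  by exists u => //; exists v.
by move=> _ [_ [u Gu [v Gv <-]] <-]; exists u => //; exists v.
Qed.

(** Positivity of [r] matters at infinity: there [jterm] is 0, while 0 to the power 0 would be 1. *)
Lemma j_finE (r : R) (G : set 'rV[R]_n) x y : 0 < r ->
  j_fin r G x y = logsup r%:E (inv_distance_pairs G x y).
Proof.
move=> r0; rewrite /j_fin /logsup; congr sup; apply/seteqP; split.
  move=> _ [a Ga <-].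
  exists (eucl (x - y) * invdist x a, eucl (x - y) * invdist y a).
    by exists a.
  by rewrite !jtermE// eucl_ge0.
by move=> _ [_ [a Ga <-] <-]; exists a => //; rewrite !jtermE// eucl_ge0.
Qed.

(** With [jE], this removes the limit at [p = +oo]: from here on finite and infinite exponents are
    treated alike through [logsup]. *)
Lemma deltaE p G a b : (0 < p)%E -> domain2 G -> G a -> G b ->
  delta p G a b = logsup p (cross_ratio_pairs G a b).
Proof.
move=> p0 DG Ga Gb; have Wb := cross_ratio_pairs_bounded _ _ _ DG Ga Gb.
case: p p0 => [r _| _|//]; first exact: delta_finE.
rewrite /delta; apply/cvg_lim => //.
have -> : (fun r => delta_fin r G a b) =
  (fun r => logsup r%:E (cross_ratio_pairs G a b)).
  by apply/funext => r; exact: delta_finE.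
exact: logsup_cvg.
Qed.

Lemma jE p (G : set 'rV[R]_n) x y : (0 < p)%E -> domain2_fin G -> G x -> G y ->
  j p G x y = logsup p (inv_distance_pairs G x y).
Proof.
move=> p0 DG Gx Gy; have Wb := inv_distance_pairs_bounded _ _ _ DG Gx Gy.
case: p p0 => [r r0| _|//]; first by apply: j_finE; rewrite -lte_fin.
rewrite /j; apply/cvg_lim => //.
apply: cvg_trans (logsup_cvg _ Wb); apply: near_eq_cvg; near=> r.
by rewrite j_finE//; near: r; exact: nbhs_pinfty_gt.
Unshelve. all: by end_near.
Qed.

End boundary_theory.

(** * Comparison of j and delta *)

Section comparison.
Context {R : realType} {n : nat}.
Implicit Types (x y : 'rV[R]_n) (a b : Rbar R n) (G : set 'rV[R]_n).

Lemma cross_ratio_swap a b (u v : Rbar R n) :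
  cross_ratio b u a v = cross_ratio a v b u.
Proof.
rewrite /cross_ratio (chordalC b a) (chordalC u v).
by congr (_ / _); rewrite mulrC.
Qed.

Lemma some_notin_neq G x (u : 'rV[R]_n) :
  open (Some @` G : set (Rbar R n)) -> G x ->
  boundary (Some @` G : set (Rbar R n)) (Some u) -> x <> u.
Proof.
move=> Go Gx Gu xu; apply: (boundary_notin _ _ _ Go Gu).
by exists x => //; rewrite xu.
Qed.

(** Infinity is not in the image of G, so if it is not a boundary point it is outside the closure.
    Some neighbourhood of infinity then misses G, which therefore lies in a compact set. *)
Lemma bounded_of_boundary G : open (Some @` G : set (Rbar R n)) ->
  ~ boundary (Some @` G : set (Rbar R n)) None ->
  exists M : R, forall x, G x -> `|x| <= M.
Proof.
move=> Go nb.
have : ~ closure (Some @` G : set (Rbar R n)) None.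
  move=> cl; apply: nb; split => // /interior_subset [z _] //.
move=> /existsNP[U /not_implyP[nU UG]].
have [K [Kc _] KU] := nU.
have [M [_ hM]] := compact_bounded Kc.
exists (M + 1) => x Gx; apply: (hM (M + 1)); first by rewrite ltrDl.
apply: contrapT => nKx; apply: UG; exists (Some x); split; first by exists x.
by apply: KU; left; exists x.
Qed.

(** The exit parameter is the supremum of all [t >= 0] with [y + t *: v] in G, finite as G is
    bounded. Openness of G keeps the exit point out of G, and approximation of the supremum puts it
    in the closure. *)
Lemma ray_exit G (y v : 'rV[R]_n) (M : R) :
  open (Some @` G : set (Rbar R n)) -> G y -> v != 0 ->
  (forall x, G x -> `|x| <= M) ->
  exists2 t : R, 0 < t & boundary (Some @` G : set (Rbar R n)) (Some (y + t *: v)).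
Proof.
move=> Go Gy v0 GM; have v1 : 0 < `|v| by rewrite normr_gt0.
pose E := [set t : R | 0 <= t /\ G (y + t *: v)].
have E0 : E 0 by split => //; rewrite scale0r addr0.
have Eb : has_ubound E.
  exists ((M + `|y|) / `|v|) => t [t0 /GM h].
  rewrite ler_pdivlMr// -(ger0_norm t0) -normrZ.
  have -> : t *: v = (y + t *: v) - y by rewrite addrAC subrr add0r.
  by apply: le_trans (ler_normB _ _) _; rewrite lerD2r.
have Es : has_sup E by split => //; exists 0.
pose s := sup E.
have s0 : 0 <= s by exact: ub_le_sup.
have dist (t : R) : `|(y + s *: v) - (y + t *: v)| = `|s - t| * `|v|.
  by rewrite opprD addrACA subrr add0r -scalerBl normrZ.
have nG : ~ G (y + s *: v).
  move=> Gs; have : nbhs (Some (y + s *: v) : Rbar R n) (Some @` G).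
    by apply: open_nbhs_nbhs; split => //; exists (y + s *: v).
  change (nbhs (y + s *: v) (Some @^-1` (Some @` G)) -> False).
  move=> /nbhs_ballP[e /= e0 eG].
  (* Half the admissible step, so that the new point stays strictly inside the ball and contradicts
     the choice of [s]. *)
  pose t := s + e / `|v| / 2.
  have st : s < t by rewrite ltrDl !divr_gt0.
  have : E t.
    split; first by rewrite (le_trans s0)// ltW.
    have [|z Gz [<-]//] := eG (y + t *: v).
    rewrite -ball_normE /ball_/= dist distrC ger0_norm ?subr_ge0 ?ltW//.
    rewrite /t addrAC subrr add0r mulrAC divfK ?gt_eqF//.
    by rewrite ltr_pdivrMr// mulr_natr mulr2n ltrDl.
  by move=> /(ub_le_sup Eb); rewrite leNgt st.
exists s.
  rewrite lt_neqAle s0 andbT; apply/eqP => e.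
  by apply: nG; rewrite -e scale0r addr0.
split; last first.
  by move=> /interior_subset[z Gz [zs]]; apply: nG; rewrite -zs.
move=> U; change (nbhs (y + s *: v) (Some @^-1` U) ->
  (Some @` G : set (Rbar R n)) `&` U !=set0).
move=> /nbhs_ballP[e /= e0 eU].
have [t [t0 Gt] st] := sup_adherent (divr_gt0 e0 v1) Es.
exists (Some (y + t *: v)); split; first by exists (y + t *: v).
apply: eU; rewrite -ball_normE /ball_/= dist -ltr_pdivlMr//.
have ts : t <= s by exact: ub_le_sup.
by rewrite ger0_norm ?subr_ge0// ltrBlDr -ltrBlDl.
Qed.

(* Inverting about a, the ray from y away from a becomes the segment from 0 to
   the image of y, along which the p-norm increases. *)
Lemma pnorm_ray p x y (a : 'rV[R]_n) (t : R) : (0 < p)%E -> 0 < t ->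
  let b := y + t *: (y - a) in x <> a -> y <> a -> x <> b -> y <> b ->
  eucl (x - a) <= eucl (y - a) ->
  pnorm p (eucl (x - y) * invdist x (Some a)) (eucl (x - y) * invdist y (Some a))
  <= pnorm p (@cross_ratio R n (Some x) (Some a) (Some y) (Some b))
       (@cross_ratio R n (Some x) (Some b) (Some y) (Some a)).
Proof.
move=> p0 t0 b xa ya xb yb.
rewrite !cross_ratioE//.
have S0 : 0 < eucl (x - a) by rewrite eucl_gt0 subr_eq0; apply/eqP.
have T0 : 0 < eucl (y - a) by rewrite eucl_gt0 subr_eq0; apply/eqP.
have X0 : 0 < eucl (x - b) by rewrite eucl_gt0 subr_eq0; apply/eqP.
have eab : eucl (a - b) = (1 + t) * eucl (y - a).
  rewrite (_ : a - b = - ((1 + t) *: (y - a))); last first.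
    by rewrite /b scalerDl scale1r !opprD opprK addrA (addrC a).
  by rewrite euclN euclZ ger0_norm// addr_ge0// ltW.
have eyb : eucl (y - b) = t * eucl (y - a).
  by rewrite /b opprD addrA subrr sub0r euclN euclZ ger0_norm// ltW.
have exb : eucl (x - b) <= eucl (x - a) + (1 + t) * eucl (y - a).
  by rewrite -eab ler_dist_euclD.
rewrite (euclB b a) /invdist eab eyb.
move: (eucl (x - y)) (eucl_ge0 (x - y)) => d d0.
move: (eucl (x - a)) (eucl (y - a)) (eucl (x - b)) S0 T0 X0 exb.
move=> S T X S0 T0 X0 XST ST.
have s0 : 0 < 1 + t by lra.
(* With shift [S / (1 + t)], the spread inverses times [d] are the first cross-ratio exactly, and a
   lower bound for the second by the triangle inequality [XST]. *)
have u0 : 0 <= S / (1 + t) by rewrite divr_ge0 ?ltW.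
have u1 : S / (1 + t) < S by rewrite ltr_pdivrMr// mulrDr mulr1 ltrDl mulr_gt0.
have := pnorm_inv_spread _ _ _ _ p0 S0 ST u0 u1.
have Su : (S - S / (1 + t)) = S * t / (1 + t) by field; rewrite gt_eqF.
have Tu : (T + S / (1 + t)) = (S + (1 + t) * T) / (1 + t).
  by field; rewrite gt_eqF.
have Y0 : 0 < S + (1 + t) * T by rewrite addr_gt0// mulr_gt0.
move=> /(ler_wpM2l d0) h.
rewrite pnormZ ?invr_ge0 ?(ltW S0) ?(ltW T0)//.
apply: le_trans h _.
rewrite -pnormZ ?invr_ge0 ?Su ?Tu ?divr_ge0 ?mulr_ge0 ?(ltW S0) ?(ltW t0)
  ?(ltW Y0) ?(ltW s0)//.
apply: ler_pnorm => //.
- by rewrite mulr_ge0// invr_ge0 !divr_ge0 ?mulr_ge0 ?(ltW S0) ?(ltW t0) ?ltW.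
- by rewrite mulr_ge0// invr_ge0 !divr_ge0 ?(ltW Y0) ?ltW.
- rewrite le_eqVlt; apply/orP; left; apply/eqP.
  by field; rewrite !gt_eqF.
- rewrite (_ : d * ((1 + t) * T) / X / T = d * (1 + t) / X); last first.
    by field; rewrite !gt_eqF.
  rewrite invf_div mulrA ler_wpM2l ?mulr_ge0 ?(ltW s0)//.
  by rewrite lef_pV2 ?posrE.
Qed.

Lemma j_le_cross_ratio p G x y a : (0 < p)%E -> domain2_fin G -> G x -> G y ->
  boundary (Some @` G : set (Rbar R n)) a ->
  exists2 b, boundary (Some @` G : set (Rbar R n)) b &
  pnorm p (eucl (x - y) * invdist x a) (eucl (x - y) * invdist y a)
  <= pnorm p (@cross_ratio R n (Some x) a (Some y) b)
       (@cross_ratio R n (Some x) b (Some y) a).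
Proof.
move=> p0 [Go _ _] Gx Gy; case: a => [a|] Ga; last first.
  (* For [a] at infinity both quotients are 0, and any boundary point would do. *)
  exists None => //; rewrite !mulr0.
  by rewrite ler_pnorm ?cross_ratio_ge0.
have neq z := some_notin_neq _ z _ Go.
have xa := neq _ _ Gx Ga; have ya := neq _ _ Gy Ga.
have [oo|noo] := pselect (boundary (Some @` G : set (Rbar R n)) None).
  by exists None => //; rewrite cross_ratioEr// cross_ratioEl// lexx.
have [M hM] := bounded_of_boundary _ Go noo.
have yax : y - a != 0 by rewrite subr_eq0; apply/eqP.
have xax : x - a != 0 by rewrite subr_eq0; apply/eqP.
have [h|/ltW h] := leP (eucl (x - a)) (eucl (y - a)).
  have [t t0 Gt] := ray_exit _ _ _ _ Go Gy yax hM.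
  exists (Some (y + t *: (y - a))) => //.
  by apply: pnorm_ray => //; [exact: neq Gx Gt|exact: neq Gy Gt].
have [t t0 Gt] := ray_exit _ _ _ _ Go Gx xax hM.
exists (Some (x + t *: (x - a))) => //.
(* Here x is the point farther from [a]: exchange the roles of x and y. *)
rewrite pnormC (pnormC _ (cross_ratio _ _ _ _)) (euclB x y).
rewrite -cross_ratio_swap -[X in _ <= pnorm _ _ X]cross_ratio_swap.
by apply: pnorm_ray => //; [exact: neq Gy Gt|exact: neq Gx Gt].
Qed.

Lemma cross_ratio_le x y a b : Some x <> a -> Some y <> b ->
  @cross_ratio R n (Some x) a (Some y) b <=
  eucl (x - y) * invdist x a + (eucl (x - y) * invdist y b
    + (eucl (x - y) * invdist x a) * (eucl (x - y) * invdist y b)).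
Proof.
have d0 := eucl_ge0 (x - y).
case: a b => [a|] [b|] xa yb.
- have {}xa : x <> a by move=> e; apply: xa; rewrite e.
  have {}yb : y <> b by move=> e; apply: yb; rewrite e.
  have S0 : 0 < eucl (x - a) by rewrite eucl_gt0 subr_eq0; apply/eqP.
  have T0 : 0 < eucl (y - b) by rewrite eucl_gt0 subr_eq0; apply/eqP.
  rewrite cross_ratioE// /invdist.
  have := le_trans (ler_dist_euclD x a b) (lerD (lexx _) (ler_dist_euclD y x b)).
  rewrite (euclB a x); move: S0 T0 d0.
  move: (eucl (x - a)) (eucl (y - b)) (eucl (x - y)) (eucl (a - b)).
  move=> S T d D S0 T0 d0 h.
  rewrite (_ : _ + _ = d * (S + (d + T)) / S / T).
    by rewrite !ler_wpM2r ?invr_ge0 ?(ltW S0) ?(ltW T0)// ler_wpM2l.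
  by field; rewrite !gt_eqF.
- have {}xa : x <> a by move=> e; apply: xa; rewrite e.
  by rewrite cross_ratioEr//= !mulr0 !addr0.
- have {}yb : y <> b by move=> e; apply: yb; rewrite e.
  by rewrite cross_ratioEl//= mulr0 mul0r add0r addr0.
- by rewrite cross_ratio_diag !mulr0 !addr0.
Qed.

(** The bounds of [cross_ratio_le] are sums of three pairs: [(Xa, Ya)], [(Yb, Xb)] and their
    coordinatewise product. Minkowski twice separates them, and [pnorm_mul] treats the product. *)
Lemma cross_ratio_pnorm_le p x y a b : (1 <= p)%E ->
  Some x <> a -> Some x <> b -> Some y <> a -> Some y <> b ->
  1 + pnorm p (@cross_ratio R n (Some x) a (Some y) b)
    (@cross_ratio R n (Some x) b (Some y) a) <=
  (1 + pnorm p (eucl (x - y) * invdist x a) (eucl (x - y) * invdist y a)) *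
  (1 + pnorm p (eucl (x - y) * invdist x b) (eucl (x - y) * invdist y b)).
Proof.
move=> p1 xa xb ya yb; have p0 : (0 < p)%E by exact: lt_le_trans p1.
have h1 := cross_ratio_le _ _ _ _ xa yb; have h2 := cross_ratio_le _ _ _ _ xb ya.
have c1 := cross_ratio_ge0 (Some x : Rbar R n) a (Some y) b.
have c2 := cross_ratio_ge0 (Some x : Rbar R n) b (Some y) a.
move: h1 h2 c1 c2; set u := cross_ratio _ _ _ _; set v := cross_ratio _ _ _ _.
have Xa := mulr_ge0 (eucl_ge0 (x - y)) (invdist_ge0 x a).
have Ya := mulr_ge0 (eucl_ge0 (x - y)) (invdist_ge0 y a).
have Xb := mulr_ge0 (eucl_ge0 (x - y)) (invdist_ge0 x b).
have Yb := mulr_ge0 (eucl_ge0 (x - y)) (invdist_ge0 y b).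
move: Xa Ya Xb Yb; clearbody u v.
move: (_ * invdist x a) (_ * invdist y a) (_ * invdist x b) (_ * invdist y b).
move=> Xa Ya Xb Yb Xa0 Ya0 Xb0 Yb0 hu hv u0 v0.
have hv' : v <= Ya + (Xb + Ya * Xb) by rewrite addrCA mulrC.
have h0 := ler_pnorm _ _ _ _ _ p0 u0 v0 hu hv'.
have h1 := pnorm_triangle _ _ _ _ _ p1 Xa0 Ya0
  (addr_ge0 Yb0 (mulr_ge0 Xa0 Yb0)) (addr_ge0 Xb0 (mulr_ge0 Ya0 Xb0)).
have h2 := pnorm_triangle _ _ _ _ _ p1 Yb0 Xb0 (mulr_ge0 Xa0 Yb0)
  (mulr_ge0 Ya0 Xb0).
have h3 := pnorm_mul _ _ _ _ _ p0 Xa0 Ya0 Yb0 Xb0.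
rewrite (pnormC _ Xb).
rewrite mulrDl mul1r mulrDr mulr1 -addrA lerD2l.
apply: le_trans h0 _; apply: le_trans h1 _.
rewrite addrC -addrA lerD2l; apply: le_trans h2 _.
by rewrite [leRHS]addrC lerD2l.
Qed.

Lemma j_le_delta p G x y : (1 <= p)%E -> domain2_fin G -> G x -> G y ->
  j p G x y <= delta_on_Rn p G x y.
Proof.
move=> p1 DG Gx Gy; have p0 : (0 < p)%E by exact: lt_le_trans p1.
have Sx : (Some @` G : set (Rbar R n)) (Some x) by exists x.
have Sy : (Some @` G : set (Rbar R n)) (Some y) by exists y.
have Wb := cross_ratio_pairs_bounded _ _ _ DG Sx Sy.
have [W0 _] := inv_distance_pairs_bounded _ _ _ DG Gx Gy.
rewrite /delta_on_Rn jE// deltaE//; apply: logsup_le => // _ [a Ga <-].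
have [b Gb h] := j_le_cross_ratio _ _ _ _ _ p0 DG Gx Gy Ga.
have Wab : cross_ratio_pairs (Some @` G) (Some x : Rbar R n) (Some y)
    (@cross_ratio R n (Some x) a (Some y) b,
     @cross_ratio R n (Some x) b (Some y) a) by exists a => //; exists b.
apply: le_trans (le_logsup _ _ _ p0 Wb Wab).
by apply: ler_ln1p => //; rewrite pnorm_ge0// mulr_ge0 ?eucl_ge0 ?invdist_ge0.
Qed.

Lemma delta_le_j p G x y : (1 <= p)%E -> domain2_fin G -> G x -> G y ->
  delta_on_Rn p G x y <= 2 * j p G x y.
Proof.
move=> p1 DG Gx Gy; have p0 : (0 < p)%E by exact: lt_le_trans p1.
have Sx : (Some @` G : set (Rbar R n)) (Some x) by exists x.
have Sy : (Some @` G : set (Rbar R n)) (Some y) by exists y.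
have [W0 _] := cross_ratio_pairs_bounded _ _ _ DG Sx Sy.
have Wb := inv_distance_pairs_bounded _ _ _ DG Gx Gy.
have [Go _ _] := DG.
rewrite /delta_on_Rn jE// deltaE//; apply: logsup_le => // _ [a Ga [b Gb <-]].
have neq z c : G z -> boundary (Some @` G : set (Rbar R n)) c -> Some z <> c.
  by move=> Gz Gc zc; apply: (boundary_notin _ _ _ Go Gc); rewrite -zc; exists z.
have inW c : boundary (Some @` G : set (Rbar R n)) c ->
    inv_distance_pairs G x y
      (eucl (x - y) * invdist x c, eucl (x - y) * invdist y c) by exists c.
have ha := le_logsup _ _ _ p0 Wb (inW _ Ga).
have hb := le_logsup _ _ _ p0 Wb (inW _ Gb).
have := cross_ratio_pnorm_le _ _ _ _ _ p1 (neq _ _ Gx Ga) (neq _ _ Gx Gb)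
  (neq _ _ Gy Ga) (neq _ _ Gy Gb).
have J0 c : 0 <= pnorm p (eucl (x - y) * invdist x c) (eucl (x - y) * invdist y c).
  by rewrite pnorm_ge0// mulr_ge0 ?eucl_ge0 ?invdist_ge0.
have C0 := pnorm_ge0 p _ (@cross_ratio R n (Some x) b (Some y) a)
  (cross_ratio_ge0 (Some x : Rbar R n) a (Some y) b).
move: ha hb (J0 a) (J0 b) C0 => /=.
move: (logsup _ _) => L; move: (pnorm _ _ _) => A.
move: (pnorm _ _ _) => B; move: (pnorm _ _ _) => C.
move=> hA hB A0 B0 C0 h.
have A1 : 0 < 1 + A by rewrite ltr_wpDr.
have B1 : 0 < 1 + B by rewrite ltr_wpDr.
have C1 : 0 < 1 + C by rewrite ltr_wpDr.
rewrite mulr_natl mulr2n; apply: le_trans (lerD hA hB).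
by rewrite -lnM ?posrE// ler_ln ?posrE// mulr_gt0.
Qed.

End comparison.

(** * Complements of sets contained in a hyperplane *)

Section punctured.
Context {R : realType} {n : nat}.
Implicit Types (A : set 'rV[R]_n) (i : 'I_n) (x y z w p a : 'rV[R]_n).

(** As [w] is off the hyperplane, a segment from a point of the set to [w] is strictly on the side
    of [w] after its starting point, and so misses [A]. The set is thus a union of segments through
    [w]. *)
Lemma connected_half A i (c : R) w : (forall z, A z -> z 0 i = 0) ->
  0 < c * w 0 i -> connected [set z : 'rV[R]_n | 0 <= c * z 0 i /\ ~ A z].
Proof.
move=> A0 w0; set H := [set z | _].
have seg z (t : R) : H z -> 0 <= t -> t <= 1 -> H (z + t *: (w - z)).
  move=> [z0 Az] t0 t1; have [->|tn0] := eqVneq t 0.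
    by rewrite scale0r addr0.
  have pos : 0 < c * (z + t *: (w - z)) 0 i.
    rewrite !mxE (_ : _ * _ = (1 - t) * (c * z 0 i) + t * (c * w 0 i)); last ring.
    apply: ltr_wpDl; first by rewrite mulr_ge0// subr_ge0.
    by rewrite mulr_gt0// lt_neqAle eq_sym tn0.
  by split; [exact: ltW|move=> /A0 e; rewrite e mulr0 ltxx in pos].
pose S z := (fun t : R => z + t *: (w - z)) @` `[0, 1].
have -> : H = \bigcup_(z in H) S z.
  apply/seteqP; split => [z Hz|z [y Hy [t]]].
    by exists z => //; exists 0; rewrite ?scale0r ?addr0//= in_itv/= lexx ler01.
  by rewrite /= in_itv/= => /andP[t0 t1] <-; exact: seg.
apply: bigcup_connected.
  exists w => z Hz; exists 1; first by rewrite /= in_itv/= lexx ler01.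
  by rewrite scale1r subrKC.
move=> z Hz; apply: connected_continuous_connected; first exact: segment_connected.
apply: continuous_subspaceT => t.
by apply: cvgD; [exact: cvg_cst|apply: cvgZr_tmp; exact: cvg_id].
Qed.

(* Each of the two closed half spaces bounded by the hyperplane, minus A, is
   star-shaped, and both contain p. *)
Lemma connected_compl A i p : (forall z, A z -> z 0 i = 0) ->
  p 0 i = 0 -> ~ A p -> connected (~` A).
Proof.
move=> A0 p0 Ap.
have -> : ~` A = [set z : 'rV[R]_n | 0 <= 1 * z 0 i /\ ~ A z] `|`
                 [set z : 'rV[R]_n | 0 <= (-1) * z 0 i /\ ~ A z].
  apply/seteqP; split => [z Az|z [[]//|[]//]].
  have [h|/ltW h] := leP 0 (z 0 i); first by left; rewrite /= mul1r.
  by right; rewrite /= mulN1r oppr_ge0.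
apply: connectedU.
- by exists p; split; rewrite /= p0 mulr0 lexx.
- by apply: (@connected_half _ i _ (delta_mx 0 i)) => //; rewrite !mxE !eqxx mulr1.
- apply: (@connected_half _ i _ (- delta_mx 0 i)) => //.
  by rewrite !mxE !eqxx mulN1r opprK.
Qed.

(** A point of [A] can be moved off the hyperplane by an arbitrarily small multiple of the [i]-th
    basis vector, and large multiples of that vector approach infinity outside [A]. *)
Lemma boundary_compl A i : closed A -> (forall z, A z -> z 0 i = 0) ->
  boundary (Some @` (~` A) : set (Rbar R n)) = Some @` A `|` [set None].
Proof.
move=> Ac A0; have Go : open (Some @` (~` A) : set (Rbar R n)).
  by apply: one_point_compactification_open_some; exact: closed_openC.
apply/seteqP; split => [[u|] Gu|].
- left; exists u => //; apply: contrapT => Au.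
  by apply: (boundary_notin _ _ _ Go Gu); exists u.
- by right.
- move=> _ [[u Au <-]|->]; (split; last by
    move=> /interior_subset[z Gz // [zu]];
    apply: Gz; rewrite zu).
  + move=> U; change (nbhs u (Some @^-1` U) ->
      (Some @` (~` A) : set (Rbar R n)) `&` U !=set0).
    move=> /nbhs_ballP[e /= e0 eU].
    pose v := u + (e / 2) *: delta_mx 0 i.
    have vA : ~ A v.
      move=> /A0; rewrite !mxE !eqxx (A0 _ Au) add0r mulr1 => /eqP.
      by rewrite gt_eqF// divr_gt0.
    exists (Some v); split; first by exists v.
    apply: eU; rewrite -ball_normE /ball_/= /v opprD addNKr.
    apply: le_lt_trans (ler_norm_eucl _) _; rewrite euclN euclZ.
    rewrite eucl_delta mulr1 ger0_norm ?divr_ge0 ?ltW//.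
    by rewrite ltr_pdivrMr// mulr_natr mulr2n ltrDl.
  + move=> U [K [Kc _] KU].
    have [M [_ hM]] := compact_bounded Kc.
    (* Off the hyperplane, and of norm above the bound [|M| + 1] on [K]. *)
    pose v : 'rV[R]_n := (`|M| + 2) *: delta_mx 0 i.
    have v0 : v 0 i = `|M| + 2 by rewrite !mxE !eqxx mulr1.
    have Mp : 0 < `|M| + 2 by rewrite ltr_wpDl.
    have vA : ~ A v by move=> /A0; rewrite v0 => /eqP; rewrite gt_eqF.
    exists (Some v); split; first by exists v.
    apply: KU; left; exists v => // Kv.
    have Mlt : M < `|M| + 1 by rewrite (le_lt_trans (ler_norm M))// ltrDl.
    have := le_trans (ler_coord_norm v i) (hM _ Mlt _ Kv).
    by rewrite v0 ger0_norm ?(ltW Mp)// lerD2l leNgt ltr1n.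
Qed.

Lemma domain_compl A i p a : closed A -> (forall z, A z -> z 0 i = 0) ->
  p 0 i = 0 -> ~ A p -> A a -> domain2_fin (~` A).
Proof.
move=> Ac A0 p0 Ap Aa; split.
- by apply: one_point_compactification_open_some; exact: closed_openC.
- apply: connected_continuous_connected; first exact: connected_compl p0 Ap.
  apply: continuous_subspaceT; exact: one_point_compactification_some_continuous.
- exists (Some a), None; rewrite (boundary_compl _ i)//; split => //.
    by left; exists a.
  by right.
Qed.

End punctured.

(** * Sharpness *)

Section ratios.
Context {R : realType}.
Implicit Types (f g t : nat -> R) (a b C : R).

(** Quantities that differ by a bounded amount while growing without bound have ratio tending to 1:
    the ratio is at least [1 - C / (i + 1)]. *)
Lemma cvg_ratio1 f g C : (forall i, f i <= g i) -> (forall i, g i <= f i + C) ->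
  (forall i, i.+1%:R <= g i) -> f i / g i @[i --> \oo] --> (1 : R).
Proof.
move=> fg gf Lg.
have C0 : 0 <= C by have := le_trans (fg 0%N) (gf 0%N); rewrite lerDl.
have g0 i : 0 < g i by apply: lt_le_trans (Lg i); rewrite ltr0n.
apply: (@squeeze_cvgr _ _ _ _ (fun i => 1 - C * harmonic i) (fun=> 1)).
- near=> i; apply/andP; split; last by rewrite ler_pdivrMr// mul1r.
  rewrite ler_pdivlMr// mulrBl mul1r lerBlDr.
  apply: le_trans (gf i) _; rewrite lerD2l -mulrA ler_peMr//.
  by rewrite /= mulrC ler_pdivlMr ?ltr0n// mul1r.
- rewrite -[X in _ --> X]subr0; apply: cvgB; first exact: cvg_cst.
  rewrite -[X in _ --> X](mulr0 C); apply: cvgMl_tmp; exact: cvg_harmonic.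
- exact: cvg_cst.
Unshelve. all: by end_near.
Qed.

(** The inequality [ln (1 + z) <= z] at [z = - s / (1 + s)], where [1 + z] is the inverse of
    [1 + s]. *)
Lemma ln1p_ge (s : R) : 0 <= s -> s / (1 + s) <= ln (1 + s).
Proof.
move=> s0; have s1 : 0 < 1 + s by rewrite ltr_pwDl.
have := @le_ln1Dx R (- (s / (1 + s))).
have -> : 1 + - (s / (1 + s)) = (1 + s)^-1 by field; rewrite gt_eqF.
rewrite lnV ?posrE// lerN2; apply.
by rewrite ltrN2 ltr_pdivrMr// mul1r ltrDr.
Qed.

Lemma cvg_ln1p_ratio t a b : 0 < a -> 0 < b -> (forall i, 0 < t i) ->
  t @ \oo --> (0 : R) ->
  ln (1 + t i * a) / ln (1 + t i * b) @[i --> \oo] --> a / b.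
Proof.
move=> a0 b0 t0 tcvg.
apply: (@squeeze_cvgr _ _ _ _ (fun i => (a / b) * (1 - t i * a))
  (fun i => (a / b) * (1 + t i * b))).
- near=> i; move: (t i) (t0 i) => s s0.
  have sa : 0 < s * a by rewrite mulr_gt0.
  have sb : 0 < s * b by rewrite mulr_gt0.
  have sa1 : 0 < 1 + s * a by rewrite addr_gt0.
  have sb1 : 0 < 1 + s * b by rewrite addr_gt0.
  have lna := ln1p_ge _ (ltW sa); have lnb := ln1p_ge _ (ltW sb).
  have lna' : ln (1 + s * a) <= s * a.
    by apply: le_ln1Dx; apply: lt_trans sa; rewrite ltrN10.
  have lnb' : ln (1 + s * b) <= s * b.
    by apply: le_ln1Dx; apply: lt_trans sb; rewrite ltrN10.
  have lb0 : 0 < ln (1 + s * b) by apply: lt_le_trans lnb; rewrite divr_gt0.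
  apply/andP; split.
    rewrite ler_pdivlMr//; apply: le_trans lna.
    (* If [1 - s * a] is negative, so is the lower bound, and nothing remains; otherwise
       [(1 - s * a) * (1 + s * a) <= 1] concludes. *)
    have [h|/ltW h] := leP 0 (1 - s * a); last first.
      apply: (@le_trans _ _ 0); last by rewrite divr_ge0 ?ltW.
      rewrite -oppr_ge0 -mulNr -mulrN mulr_ge0 ?(ltW lb0)//.
      by rewrite mulr_ge0 ?oppr_ge0// divr_ge0 ?ltW.
    apply: (@le_trans _ _ (a / b * (1 - s * a) * (s * b))).
      by rewrite ler_wpM2l// mulr_ge0// divr_ge0 ?ltW.
    rewrite ler_pdivlMr// [leLHS](_ : _ = s * a * (1 - (s * a) ^+ 2)); last first.
      by field; rewrite gt_eqF.
    by rewrite ler_piMr ?(ltW sa)// gerBl sqr_ge0.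
  rewrite ler_pdivrMr//; apply: le_trans lna' _.
  have ab : 0 <= a / b * (1 + s * b) by rewrite mulr_ge0 ?divr_ge0 ?ltW.
  apply: le_trans (ler_wpM2l ab lnb).
  rewrite le_eqVlt; apply/orP; left; apply/eqP; field.
  by rewrite !gt_eqF.
- rewrite -[X in _ --> X]mulr1; apply: cvgMl_tmp.
  rewrite -[X in _ --> X]subr0; apply: cvgB; first exact: cvg_cst.
  by rewrite -[X in _ --> X](mul0r a); exact: cvgMr_tmp.
- rewrite -[X in _ --> X]mulr1; apply: cvgMl_tmp.
  rewrite -[X in _ --> X]addr0; apply: cvgD; first exact: cvg_cst.
  by rewrite -[X in _ --> X](mul0r b); exact: cvgMr_tmp.
Unshelve. all: by end_near.
Qed.

(** Both sides are 2^(1/p). By [const2_div] the constant of (i) and (ii) is a ratio of two such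
    norms, which suggests looking for pairs with equal coordinates. *)
Lemma pnorm11 (p : \bar R) : (0 < p)%E -> pnorm p 1 1 = const2 p +oo%E.
Proof.
case: p => [r| |//]; rewrite /const2 /pnorm invey ?inver subr0.
  by rewrite lte_fin => r0; rewrite gt_eqF//= powR1 div1r.
by move=> _; rewrite powRr0 maxxx.
Qed.

Lemma const2_div (q p : \bar R) :
  (const2 q +oo%E : R) / const2 p +oo%E = const2 q p.
Proof. by rewrite /const2 invey /= !subr0 powRB// pnatr_eq0 implybT. Qed.

End ratios.

(** * Sharpness on the once punctured space *)

Section sharpness.
Context {R : realType} {n : nat} (i0 i1 : 'I_n) (i01 : i0 != i1).
Implicit Types (p q : \bar R) (x y : 'rV[R]_n).

Let i10 : (i1 == i0) = false.
Proof. by rewrite eq_sym; exact: negPf. Qed.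

Let e (k : 'I_n) : 'rV[R]_n := delta_mx 0 k.

Let closed1 x : closed [set x].
Proof.
by apply: accessible_closed_set1; apply/hausdorff_accessible/norm_hausdorff.
Qed.

Let e_neq0 k : e k != 0.
Proof. by rewrite -eucl_gt0 eucl_delta. Qed.

Let G1 : set 'rV[R]_n := ~` [set 0].

Let G1_domain : domain2_fin G1.
Proof.
apply: (@domain_compl _ _ _ i1 (e i0) 0) => //.
- by move=> _ ->; rewrite mxE.
- by rewrite mxE i10 andbF.
- by apply/eqP; exact: e_neq0.
Qed.

Let G1_boundary : boundary (Some @` G1 : set (Rbar R n)) =
  [set Some 0] `|` [set None].
Proof.
rewrite (boundary_compl _ i0)// ?image_set1//.
by move=> _ ->; rewrite mxE.
Qed.

Let F p x y : R :=
  ln (1 + pnorm p (eucl (x - y) / eucl x) (eucl (x - y) / eucl y)).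

Let pnorm_ge00 p (u v : R) : (0 < p)%E -> 0 <= u -> 0 <= v ->
  pnorm p 0 0 <= pnorm p u v.
Proof. by move=> p0 u0 v0; apply: ler_pnorm. Qed.

Let j_punctured p x y : (0 < p)%E -> x != 0 -> y != 0 -> j p G1 x y = F p x y.
Proof.
move=> p0 /eqP x0 /eqP y0; rewrite jE//.
have Wb := inv_distance_pairs_bounded _ _ _ G1_domain x0 y0.
apply: (logsup_max _ _ _ _ Wb p0) => /=.
  by exists (Some 0); rewrite /= ?subr0// G1_boundary; left.
move=> w [a]; rewrite G1_boundary => -[->|->] <-/=; rewrite ?subr0 ?lexx//.
by rewrite !mulr0 pnorm_ge00// divr_ge0 ?eucl_ge0.
Qed.

Let delta_punctured p x y : (0 < p)%E -> x != 0 -> y != 0 ->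
  delta_on_Rn p G1 x y = F p x y.
Proof.
move=> p0 /eqP x0 /eqP y0.
have Sx : (Some @` G1 : set (Rbar R n)) (Some x) by exists x.
have Sy : (Some @` G1 : set (Rbar R n)) (Some y) by exists y.
rewrite /delta_on_Rn deltaE//.
have Wb := cross_ratio_pairs_bounded _ _ _ G1_domain Sx Sy.
apply: (logsup_max _ _ _ _ Wb p0) => /=.
  exists (Some 0); first by rewrite G1_boundary; left.
  exists None; first by rewrite G1_boundary; right.
  by rewrite cross_ratioEr// cross_ratioEl//= !subr0.
have d0 (z : 'rV[R]_n) : 0 <= eucl (x - y) / eucl z by rewrite divr_ge0 ?eucl_ge0.
(* Equal boundary points give the pair [(0, 0)]; the two orders of 0 and infinity give the same pair
   up to a swap. *)
move=> w [a]; rewrite G1_boundary => -[->|->] [b [->|->] <-]/=.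
- by rewrite !cross_ratio_diag pnorm_ge00.
- by rewrite cross_ratioEr// cross_ratioEl//= !subr0 lexx.
- by rewrite cross_ratioEr// cross_ratioEl//= !subr0 pnormC lexx.
- by rewrite !cross_ratio_diag pnorm_ge00.
Qed.

(** Exponential growth, so that the logarithm is at least [k.+1], as [cvg_ratio1] requires:
    [eucl (xs k) = 1] and [xs k] has distance [E k] from [ys k]. *)
Let E (k : nat) : R := expR k.+1%:R.

Let xs (k : nat) := e i0.
Let ys (k : nat) := (1 + E k) *: e i0.

Let xs_neq0 k : xs k != 0. Proof. exact: e_neq0. Qed.
Let ys_neq0 k : ys k != 0.
Proof.
by rewrite scaler_eq0 (negPf (e_neq0 _)) orbF gt_eqF// addr_gt0 ?expR_gt0.
Qed.
Let xys_neq k : xs k <> ys k.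
Proof.
move=> /eqP; rewrite -subr_eq0 /xs /ys scalerDl scale1r opprD addNKr oppr_eq0.
by rewrite scaler_eq0 (negPf (e_neq0 _)) orbF gt_eqF// expR_gt0.
Qed.

Let F_ge p k : (0 < p)%E -> k.+1%:R <= F p (xs k) (ys k).
Proof.
move=> p0.
have -> : k.+1%:R = ln (E k) by rewrite expRK.
rewrite ler_ln ?posrE ?expR_gt0//; last first.
  by rewrite ltr_wpDr// pnorm_ge0// divr_ge0 ?eucl_ge0.
apply: ler_wpDl => //.
apply: le_trans (le_pnorm_l _ _ _ p0 _ _); rewrite ?divr_ge0 ?eucl_ge0//.
rewrite /xs eucl_delta divr1 /ys scalerDl scale1r opprD addNKr euclN euclZ.
by rewrite eucl_delta mulr1 ler_norm.
Qed.

Let F_antitone p q x y : (0 < q)%E -> (q <= p)%E -> F p x y <= F q x y.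
Proof.
move=> q0 qp.
have d0 (z : 'rV[R]_n) : 0 <= eucl (x - y) / eucl z by rewrite divr_ge0 ?eucl_ge0.
by apply: ler_ln1p; rewrite ?pnorm_ge0// pnorm_antitone.
Qed.

(** Unlike [logsup_equiv] this bound is additive, from [1 + c * A <= c * (1 + A)]; it is the bounded
    difference in [cvg_ratio1]. *)
Let F_le p q x y : (0 < q)%E -> (q <= p)%E ->
  F q x y <= F p x y + ln (const2 q p).
Proof.
move=> q0 qp.
have d0 (z : 'rV[R]_n) : 0 <= eucl (x - y) / eucl z by rewrite divr_ge0 ?eucl_ge0.
have c1 : (1 : R) <= const2 q p by exact: const2_ge1.
have c0 : 0 < const2 q p :> R by exact: lt_le_trans c1.
have := pnorm_equiv _ _ _ _ q0 qp (d0 x) (d0 y).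
have := pnorm_ge0 q _ (eucl (x - y) / eucl y) (d0 x).
have := pnorm_ge0 p _ (eucl (x - y) / eucl y) (d0 x).
rewrite /F; move: (pnorm p _ _) => A; move: (pnorm q _ _) => B A0 B0 BA.
rewrite -lnM ?posrE ?ltr_wpDr// ler_ln ?posrE ?mulr_gt0 ?ltr_wpDr//.
by rewrite mulrDl mul1r [A * _]mulrC lerD.
Qed.

Let cvg1 p q : (0 < q)%E -> (q <= p)%E ->
  F p (xs k) (ys k) / F q (xs k) (ys k) @[k --> \oo] --> (1 : R).
Proof.
move=> q0 qp; apply: (@cvg_ratio1 _ _ _ (ln (const2 q p))) => k.
- exact: F_antitone.
- exact: F_le.
- exact: F_ge.
Qed.

(** Mirror images in the hyperplane orthogonal to [e i0]: equal norms make the two quotients equal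
    to one [t k], which tends to 0 as the points approach each other. *)
Let us (k : nat) := e i1 + k.+1%:R^-1 *: e i0.
Let vs (k : nat) := e i1 - k.+1%:R^-1 *: e i0.

Let us_ge1 k : 1 <= eucl (us k).
Proof.
apply: le_trans (ler_coord_eucl _ i1).
by rewrite !mxE !eqxx i10 andbF mulr0 addr0 normr1.
Qed.

Let eucl_vs k : eucl (vs k) = eucl (us k).
Proof.
congr Num.sqrt; apply: eq_bigr => l _; rewrite !mxE.
have [->|_] := eqVneq l i1; last by rewrite andbF !add0r sqrrN.
by rewrite i10 andbF mulr0 addr0 subr0.
Qed.

Let us_neq0 k : us k != 0.
Proof. by rewrite -eucl_gt0 (lt_le_trans ltr01). Qed.
Let vs_neq0 k : vs k != 0.
Proof. by rewrite -eucl_gt0 eucl_vs (lt_le_trans ltr01). Qed.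

Let eucl_uv k : eucl (us k - vs k) = 2 * k.+1%:R^-1.
Proof.
have -> : us k - vs k = (2 * k.+1%:R^-1) *: e i0.
  rewrite /us /vs opprD opprK addrACA subrr add0r -scalerDl.
  by congr (_ *: _); ring.
by rewrite euclZ eucl_delta mulr1 ger0_norm.
Qed.

Let uv_neq k : us k <> vs k.
Proof.
move=> uv; have := eucl_uv k; rewrite uv subrr => /esym/eqP.
have /eqP -> : eucl (0 : 'rV[R]_n) == 0 by rewrite eucl_eq0.
by rewrite mulf_eq0 pnatr_eq0/= invr_eq0 pnatr_eq0.
Qed.

Let t (k : nat) := eucl (us k - vs k) / eucl (us k).

Let F_uv p k : (0 < p)%E -> F p (us k) (vs k) = ln (1 + t k * const2 p +oo%E).
Proof.
move=> p0; rewrite /F eucl_vs -/(t k) -pnorm11// -pnormZ ?mulr1//.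
by rewrite divr_ge0 ?eucl_ge0.
Qed.

Let t_cvg : t @ \oo --> (0 : R).
Proof.
apply: (@squeeze_cvgr _ _ _ _ (fun=> 0) (fun k => 2 * harmonic k)).
- near=> k; rewrite divr_ge0 ?eucl_ge0//= /t eucl_uv.
  by rewrite ler_pdivrMr ?(lt_le_trans ltr01)// ler_peMr.
- exact: cvg_cst.
- rewrite -[X in _ --> X](mulr0 2); apply: cvgMl_tmp; exact: cvg_harmonic.
Unshelve. all: by end_near.
Qed.

Let cvg2 p q : (0 < q)%E -> (q <= p)%E ->
  F q (us k) (vs k) / F p (us k) (vs k) @[k --> \oo] --> (const2 q p : R).
Proof.
move=> q0 qp; have p0 := lt_le_trans q0 qp; rewrite -const2_div.
have -> : (fun k => F q (us k) (vs k) / F p (us k) (vs k)) =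
  (fun k => ln (1 + t k * const2 q +oo%E) / ln (1 + t k * const2 p +oo%E)).
  by apply/funext => k; rewrite !F_uv.
have c0 r : 0 < const2 r +oo%E :> R by rewrite powR_gt0.
apply: cvg_ln1p_ratio => // k.
by rewrite /t eucl_uv divr_gt0 ?mulr_gt0 ?invr_gt0
   ?ltr0n ?(lt_le_trans ltr01 (us_ge1 k)).
Qed.

Lemma j_sharp q p : (0 < q)%E -> (q <= p)%E ->
  sharp (@domain2_fin R n) (@j R n p) 1 (@j R n q) /\
  sharp (@domain2_fin R n) (@j R n q) (const2 q p) (@j R n p).
Proof.
move=> q0 qp; have p0 := lt_le_trans q0 qp; split.
- exists G1, xs, ys; split=> //.
    by move=> k; split=> //; apply/eqP.
  by under eq_fun do rewrite !j_punctured//; exact: cvg1.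
- exists G1, us, vs; split=> //.
    by move=> k; split=> //; apply/eqP.
  by under eq_fun do rewrite !j_punctured//; exact: cvg2.
Qed.

Lemma delta_sharp q p : (0 < q)%E -> (q <= p)%E ->
  sharp (@domain2 R n) (@delta R n p) 1 (@delta R n q) /\
  sharp (@domain2 R n) (@delta R n q) (const2 q p) (@delta R n p).
Proof.
move=> q0 qp; have p0 := lt_le_trans q0 qp.
have S (z : 'rV[R]_n) : z != 0 -> (Some @` G1 : set (Rbar R n)) (Some z).
  by move=> /eqP z0; exists z.
split.
- exists (Some @` G1), (Some \o xs), (Some \o ys); split=> //.
    by move=> k; split; [exact: S|exact: S|case; exact: xys_neq].
  have := cvg1 _ _ q0 qp.
  by under eq_fun do rewrite -!delta_punctured//.
- exists (Some @` G1), (Some \o us), (Some \o vs); split=> //.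
    by move=> k; split; [exact: S|exact: S|case; exact: uv_neq].
  have := cvg2 _ _ q0 qp.
  by under eq_fun do rewrite -!delta_punctured//.
Qed.

Lemma j_delta_sharp p : (0 < p)%E ->
  sharp (@domain2_fin R n) (@j R n p) 1 (@delta_on_Rn R n p).
Proof.
move=> p0; exists G1, xs, ys; split=> //.
  by move=> k; split=> //; apply/eqP.
(* Both functions equal [F p] here, so equal exponents suffice. *)
have := cvg1 p p p0 (lexx _).
by under eq_fun do rewrite -{1}j_punctured// -delta_punctured//.
Qed.

End sharpness.

(** * Sharpness of the constant 2 on the twice punctured space *)

Section sharpness2.
Context {R : realType} {n : nat} (i0 i1 : 'I_n) (i01 : i0 != i1).
Implicit Types (p : \bar R) (x y : 'rV[R]_n).

Let e : 'rV[R]_n := delta_mx 0 i0.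

Let e_neq0 : e != 0.
Proof. by rewrite -eucl_gt0 eucl_delta. Qed.

Let eucl_e (c : R) : eucl (c *: e) = `|c|.
Proof. by rewrite euclZ eucl_delta mulr1. Qed.

Let G : set 'rV[R]_n := ~` [set 0; e].

Let closed_ends : closed [set 0; e].
Proof.
by apply: closedU; apply: accessible_closed_set1;
  apply/hausdorff_accessible/norm_hausdorff.
Qed.

Let ends0 z : [set 0; e] z -> z 0 i1 = 0.
Proof. by move=> [->|->]; rewrite mxE// eq_sym (negPf i01) andbF. Qed.

Let G_domain : domain2_fin G.
Proof.
(* Both removed points lie in the hyperplane of vanishing [i1]-th coordinate, and [- e] is another
   point of it. *)
apply: (@domain_compl _ _ _ i1 (- e) 0) => //; last by left.
  by rewrite !mxE eq_sym (negPf i01) andbF oppr0.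
move=> [/eqP|/eqP]; first by rewrite oppr_eq0 (negPf e_neq0).
by rewrite -subr_eq0 -opprD oppr_eq0 -[e]scale1r -scalerDl scaler_eq0
  (negPf e_neq0) orbF -[1 + 1]/(2%:R) pnatr_eq0.
Qed.

Let G_boundary : boundary (Some @` G : set (Rbar R n)) =
  Some @` [set 0; e] `|` [set None].
Proof. by apply: (boundary_compl _ i1 closed_ends) => z; exact: ends0. Qed.

(** The point [x k] is at distance [(N k)^-1] from 0, and [y k] at the same distance from [e]. The
    factor 4 keeps [x k] and [y k] at least 1/2 apart, and the exponential again serves
    [cvg_ratio1]. *)
Let E (k : nat) : R := expR k.+1%:R.
Let N (k : nat) : R := 4 * E k.

Let E_ge1 k : 1 <= E k.
Proof. by rewrite -expR0 ler_expR. Qed.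

Let N_ge4 k : 4 <= N k.
Proof. by have := E_ge1 k; rewrite /N; lra. Qed.

Let x (k : nat) : 'rV[R]_n := (N k)^-1 *: e.
Let y (k : nat) : 'rV[R]_n := (1 - (N k)^-1) *: e.

Let line_notin (c : R) : c != 0 -> c != 1 -> G (c *: e).
Proof.
move=> c0 c1 [/eqP|/eqP]; first by rewrite scaler_eq0 (negPf c0) (negPf e_neq0).
rewrite -subr_eq0 -{2}[e]scale1r -scalerBl scaler_eq0 subr_eq0.
by rewrite (negPf c1) (negPf e_neq0).
Qed.

Let Gx k : G (x k).
Proof.
have := N_ge4 k; rewrite /x; move: (N k) => M M4.
by apply: line_notin; rewrite ?invr_eq0 ?invr_eq1; apply/eqP; lra.
Qed.

Let inv_bound k : 0 < (N k)^-1 /\ (N k)^-1 <= 1 / 4.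
Proof.
have := N_ge4 k; move: (N k) => M M4.
split; first by rewrite invr_gt0; lra.
by rewrite div1r lef_pV2 ?posrE; lra.
Qed.

Let Gy k : G (y k).
Proof.
have [h1 h2] := inv_bound k; apply: line_notin; apply/eqP => h; lra.
Qed.

Let dist_xy k : eucl (x k - y k) = 1 - 2 * (N k)^-1.
Proof.
have [h1 h2] := inv_bound k.
by rewrite /x /y -scalerBl eucl_e ler0_norm; lra.
Qed.

Let xy_neq k : x k <> y k.
Proof.
move=> h; have := dist_xy k; rewrite h subrr.
have /eqP -> : eucl (0 : 'rV[R]_n) == 0 by rewrite eucl_eq0.
by have [h1 h2] := inv_bound k; lra.
Qed.

Let dist_ge z k : (z = x k \/ z = y k) ->
  (N k)^-1 <= eucl (z - 0) /\ (N k)^-1 <= eucl (z - e).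
Proof.
have [h1 h2] := inv_bound k; rewrite subr0 -[X in _ - X]scale1r.
move=> [->|->]; rewrite /x /y -scalerBl !eucl_e.
  by split; rewrite ler_normr; apply/orP; [left|right]; lra.
by split; rewrite ler_normr; apply/orP; [left|right]; lra.
Qed.

Let invdist_le z a k : (z = x k \/ z = y k) ->
  boundary (Some @` G : set (Rbar R n)) a -> invdist z a <= N k.
Proof.
move=> /dist_ge[h1 h2]; have N4 := N_ge4 k; have [b1 _] := inv_bound k.
have N0 : 0 < N k by apply: lt_le_trans N4.
rewrite G_boundary => -[[_ [->|->] <-]|->] /=; last exact: ltW.
- by rewrite -[leRHS]invrK lef_pV2 ?posrE// (lt_le_trans b1).
- by rewrite -[leRHS]invrK lef_pV2 ?posrE// (lt_le_trans b1).
Qed.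

(** Both quotients are at most [N k], so for [p >= 1] the norm is at most [2 * N k], and
    [1 + 2 * N k <= 3 * N k]. *)
Let j_le p k : (1 <= p)%E -> 2 * j p G (x k) (y k) <= ln ((3 * N k) ^+ 2).
Proof.
move=> p1; have p0 : (0 < p)%E by exact: lt_le_trans p1.
have N4 := N_ge4 k; have N0 : 0 < N k by apply: lt_le_trans N4.
have N30 : 0 < 3 * N k by rewrite mulr_gt0.
rewrite lnXn// -[leRHS]mulr_natl ler_pM2l// jE//; apply: logsup_le.
  by have [] := inv_distance_pairs_bounded _ _ _ G_domain (Gx k) (Gy k).
move=> _ [a Ga <-] /=.
have d0 := eucl_ge0 (x k - y k).
have d1 : eucl (x k - y k) <= 1.
  by rewrite dist_xy; have [h1 h2] := inv_bound k; lra.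
have hle z : z = x k \/ z = y k -> eucl (x k - y k) * invdist z a <= N k.
  move=> hz; apply: le_trans (invdist_le _ _ _ hz Ga).
  by rewrite ler_piMl ?invdist_ge0.
have ge0 (z : 'rV[R]_n) : 0 <= eucl (x k - y k) * invdist z a.
  by rewrite mulr_ge0 ?invdist_ge0.
have h : pnorm p (eucl (x k - y k) * invdist (x k) a)
    (eucl (x k - y k) * invdist (y k) a) <= 2 * N k.
  apply: le_trans (ler_pnorm _ _ _ (N k) (N k) p0 _ _ _ _) _ => //.
  - by apply: hle; left.
  - by apply: hle; right.
  - apply: le_trans (pnorm_antitone p 1%:E _ _ _ p1 (ltW N0) (ltW N0)) _ => //.
    by rewrite /pnorm divr1 !powRr1 ?addr_ge0 ?(ltW N0)// mulr_natl mulr2n.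
have := pnorm_ge0 p _ (eucl (x k - y k) * invdist (y k) a) (ge0 (x k)).
move: h; move: (pnorm _ _ _) => P h P0.
by rewrite ler_ln ?posrE//; lra.
Qed.

(** The boundary points 0 and [e] give the cross-ratio [(1 - 2 / N k) * N k ^+ 2]: it is quadratic
    in [N k], whereas the quotients in [j] are linear. *)
Let delta_ge p k : (1 <= p)%E ->
  ln (N k ^+ 2 / 2) <= delta_on_Rn p G (x k) (y k).
Proof.
move=> p1; have p0 : (0 < p)%E by exact: lt_le_trans p1.
have N4 := N_ge4 k; have N0 : 0 < N k by apply: lt_le_trans N4.
have Sx : (Some @` G : set (Rbar R n)) (Some (x k)) by exists (x k).
have Sy : (Some @` G : set (Rbar R n)) (Some (y k)) by exists (y k).
rewrite /delta_on_Rn deltaE//.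
have Wb := cross_ratio_pairs_bounded _ _ _ G_domain Sx Sy.
have W : cross_ratio_pairs (Some @` G) (Some (x k) : Rbar R n) (Some (y k))
    (@cross_ratio R n (Some (x k)) (Some 0) (Some (y k)) (Some e),
     @cross_ratio R n (Some (x k)) (Some e) (Some (y k)) (Some 0)).
  exists (Some 0); first by rewrite G_boundary; left; exists 0 => //; left.
  by exists (Some e) => //; rewrite G_boundary; left; exists e => //; right.
apply: le_trans (le_logsup _ _ _ p0 Wb W) => /=.
have c0 := cross_ratio_ge0 (Some (x k) : Rbar R n) (Some 0) (Some (y k)) (Some e).
have d0 := cross_ratio_ge0 (Some (x k) : Rbar R n) (Some e) (Some (y k)) (Some 0).
have h : N k ^+ 2 / 2 <=
    @cross_ratio R n (Some (x k)) (Some 0) (Some (y k)) (Some e).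
  rewrite cross_ratioE.
  - have [h1 h2] := inv_bound k.
    have -> : invdist (x k) (Some 0) = N k.
      by rewrite /= subr0 eucl_e gtr0_norm// invrK.
    have -> : invdist (y k) (Some e) = N k.
      rewrite /= /y scalerBl scale1r addrAC subrr add0r euclN eucl_e.
      by rewrite gtr0_norm// invrK.
    rewrite dist_xy sub0r euclN eucl_delta mulr1 -mulrA -expr2 mulrC.
    by rewrite ler_wpM2r ?sqr_ge0//; lra.
  - by move=> x0; apply: (Gx k); left.
  - by move=> y0; apply: (Gy k); right.
have := le_pnorm_l _ _ _ p0 c0 d0; move: h.
move: (cross_ratio _ _ _ _) => C h hP.
have N2 : 0 < N k ^+ 2 / 2 by rewrite divr_gt0 ?exprn_gt0.
move: hP; move: (pnorm _ _ _) => P hP.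
by rewrite ler_ln ?posrE//; lra.
Qed.

Lemma delta_j_sharp p : (1 <= p)%E ->
  sharp (@domain2_fin R n) (@delta_on_Rn R n p) 2 (@j R n p).
Proof.
move=> p1; exists G, x, y; split=> //.
have -> : (fun k => delta_on_Rn p G (x k) (y k) / j p G (x k) (y k)) =
  (fun k => 2 * (delta_on_Rn p G (x k) (y k) / (2 * j p G (x k) (y k)))).
  by apply/funext => k; rewrite invfM mulrCA mulVKf.
rewrite -[X in _ --> X]mulr1; apply: cvgMl_tmp.
have N0 k : 0 < N k by apply: lt_le_trans (N_ge4 k).
have djk k := delta_le_j _ _ _ _ p1 G_domain (Gx k) (Gy k).
(* The constant 18 is the quotient of [(3 * N k) ^+ 2] by [N k ^+ 2 / 2]. *)
apply: (@cvg_ratio1 _ _ _ (ln 18)) => k //.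
- apply: le_trans (j_le _ _ p1) _.
  apply: le_trans (lerD (delta_ge _ k p1) (lexx _)).
  rewrite -lnM ?posrE ?divr_gt0 ?exprn_gt0//.
  by rewrite le_eqVlt; apply/orP; left; apply/eqP; congr ln; field.
- apply: le_trans (djk k); apply: le_trans (delta_ge _ k p1).
  rewrite -[leLHS]expRK -/(E k) ler_ln ?posrE ?divr_gt0 ?exprn_gt0 ?expR_gt0//.
  by have := E_ge1 k; rewrite /N; move: (E k) => M M1; nra.
Qed.

End sharpness2.

Theorem theorem1p5 (R : realType) (n : nat) (hn : (2 <= n)%N) :
  (* (i) *)
  (forall G : set (Rbar R n), domain2 G ->
   forall q p : \bar R, (0 < q)%E -> (q <= p)%E ->
   forall x y : Rbar R n, G x -> G y ->
     delta p G x y <= delta q G x y /\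
     delta q G x y <= const2 q p * delta p G x y) /\
  (* (ii) *)
  (forall G : set 'rV[R]_n, domain2_fin G ->
   forall q p : \bar R, (0 < q)%E -> (q <= p)%E ->
   forall x y : 'rV[R]_n, G x -> G y ->
     j p G x y <= j q G x y /\
     j q G x y <= const2 q p * j p G x y) /\
  (* (iii) *)
  (forall G : set 'rV[R]_n, domain2_fin G ->
   forall p : \bar R, (1 <= p)%E ->
   forall x y : 'rV[R]_n, G x -> G y ->
     j p G x y <= delta_on_Rn p G x y /\
     delta_on_Rn p G x y <= 2 * j p G x y) /\
  (* sharpness in (i), (ii), (iii) *)
  (forall q p : \bar R, (0 < q)%E -> (q <= p)%E ->
     sharp (@domain2 R n) (@delta R n p) 1 (@delta R n q) /\
     sharp (@domain2 R n) (@delta R n q) (const2 q p) (@delta R n p)) /\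
  (forall q p : \bar R, (0 < q)%E -> (q <= p)%E ->
     sharp (@domain2_fin R n) (@j R n p) 1 (@j R n q) /\
     sharp (@domain2_fin R n) (@j R n q) (const2 q p) (@j R n p)) /\
  (forall p : \bar R, (1 <= p)%E ->
     sharp (@domain2_fin R n) (@j R n p) 1 (@delta_on_Rn R n p) /\
     sharp (@domain2_fin R n) (@delta_on_Rn R n p) 2 (@j R n p)).
Proof.
(* Two distinct coordinates, from [n >= 2]: the removed points then lie in a coordinate hyperplane
   containing further points, which keeps the complement connected. *)
pose i0 : 'I_n := Ordinal (ltn_trans (ltnSn 0) hn); pose i1 : 'I_n := Ordinal hn.
have i01 : i0 != i1 by [].
split.
  move=> G DG q p q0 qp x y Gx Gy.
  have Wb := cross_ratio_pairs_bounded _ _ _ DG Gx Gy.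
  rewrite !deltaE ?(lt_le_trans q0 qp)//.
  by split; [exact: logsup_antitone|exact: logsup_equiv].
split.
  move=> G DG q p q0 qp x y Gx Gy.
  have Wb := inv_distance_pairs_bounded _ _ _ DG Gx Gy.
  rewrite !jE ?(lt_le_trans q0 qp)//.
  by split; [exact: logsup_antitone|exact: logsup_equiv].
split.
  move=> G DG p p1 x y Gx Gy.
  by split; [exact: j_le_delta|exact: delta_le_j].
split; first by move=> q p; exact: (delta_sharp i0 i1).
split; first by move=> q p; exact: (j_sharp i0 i1).
move=> p p1; split; last exact: (delta_j_sharp i0 i1).
by apply: (j_delta_sharp i0 i1) => //; exact: lt_le_trans p1.
Qed.
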